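(* Let $n\ge 3$, let $X_1,\ldots,X_n$ be Banach spaces, at least three of them infinite-dimensional, and let $p_1,\ldots,p_n\ge 1$. Then there exists a continuous $n$-linear form $A\colon X_1\times\cdots\times X_n\to\mathbb{K}$ which fails to be $(p_1,\ldots,p_n)$-dominated.
   Context: Here $n$ is a positive integer and $X_1,\ldots,X_n$ are Banach spaces over $\mathbb{K}=\mathbb{R}$ or $\mathbb{C}$. $X'$ denotes the topological dual of a Banach space $X$. For $0<q<+\infty$, $\ell_q$ is the space of scalar sequences $(a_j)_{j=1}^\infty$ with $\sum_{j=1}^\infty|a_j|^q<\infty$. For $1\le p<+\infty$, $\ell_p^w(X)$ is the space of sequences $(x_j)_{j=1}^\infty$ in $X$ such that $(\varphi(x_j))_{j=1}^\infty\in\ell_p$ for every $\varphi\in X'$. A continuous $n$-linear form $A\colon X_1\times\cdots\times X_n\to\mathbb{K}$ is $(p_1,\ldots,p_n)$-dominated, $1\le p_1,\ldots,p_n<+\infty$, if $(A(x_j^1,\ldots,x_j^n))_{j=1}^\infty\in\ell_q$ whenever $(x_j^k)_{j=1}^\infty\in\ell_{p_k}^w(X_k)$, $k=1,\ldots,n$, where $\frac1q=\frac1{p_1}+\cdots+\frac1{p_n}$.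
   Formalization: The formal theorem also assumes that every Banach space X_i is nonzero; if some X_i = {0} (e.g. n = 4, X_4 = {0}), the only n-linear form is 0, which is dominated, so the claim fails exactly in these cases. *)

(* Defs.v *)
From HB Require Import structures.
From mathcomp Require Import all_boot all_order all_algebra.
From mathcomp Require Import all_classical all_reals all_analysis.
From mathcomp Require Import complex.

Set Implicit Arguments.
Unset Strict Implicit.
Unset Printing Implicit Defensive.

Import Order.TTheory GRing.Theory Num.Theory numFieldNormedType.Exports.

Local Open Scope classical_set_scope.
Local Open Scope ring_scope.

Variant scalar_kind := RealScalars | ComplexScalars.

Definition scalar_field (R : realType) (k : scalar_kind) : numFieldType :=
  match k with
  | RealScalars => R
  | ComplexScalars => R[i]
  end.

(* On [R[i]] the norm [`|z|] takes its values in [R[i]] itself; real exponents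
   require the modulus as an element of [R]. *)
Definition modulus (R : realType) (k : scalar_kind) : scalar_field R k -> R :=
  match k return scalar_field R k -> R with
  | RealScalars => fun x : R => `|x|
  | ComplexScalars => fun z : R[i] => ComplexField.Normc.normc z
  end.

Definition ell (R : realType) (k : scalar_kind) (q : R)
    (a : nat -> scalar_field R k) : Prop :=
  (\sum_(0 <= j <oo) ((modulus (a j)) `^ q)%:E < +oo)%E.

Definition weak_ell (R : realType) (k : scalar_kind)
    (X : normedModType (scalar_field R k)) (p : R) (x : nat -> X) : Prop :=
  forall phi : {linear X -> (scalar_field R k)^o},
    continuous phi -> ell p (fun j => phi (x j)).

Definition infinite_dimensional (K : numFieldType) (X : normedModType K) : Prop :=
  ~ exists (m : nat) (b : 'I_m -> X),
      forall x : X, exists c : 'I_m -> K, x = \sum_(i < m) c i *: b i.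

Definition multilinear (K : numFieldType) (n : nat)
    (X : 'I_n -> completeNormedModType K) (A : (forall i, X i) -> K^o) : Prop :=
  forall (i : 'I_n) (x : forall j, X j),
    linear (fun t : X i => A (dfwith x i t)).

Definition continuous_multilinear (K : numFieldType) (n : nat)
    (X : 'I_n -> completeNormedModType K) (A : (forall i, X i) -> K^o) : Prop :=
  multilinear A /\ continuous (A : prod_topology X -> K^o).

Definition dominated (R : realType) (k : scalar_kind) (n : nat)
    (X : 'I_n -> completeNormedModType (scalar_field R k)) (p : 'I_n -> R)
    (A : (forall i, X i) -> (scalar_field R k)^o) : Prop :=
  forall x : (forall i, nat -> X i),
    (forall i, weak_ell (p i) (x i)) ->
    ell (\sum_(i < n) (p i)^-1)^-1 (fun j => A (fun i => x i j)).

(* Main.v *)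
Require Import Defs.
From HB Require Import structures.
From mathcomp Require Import all_boot all_order all_algebra.
From mathcomp Require Import all_classical all_reals all_analysis.
From mathcomp Require Import complex.
From mathcomp Require Import perm ring lra zify.
Import Order.TTheory GRing.Theory Num.Theory numFieldNormedType.Exports.
Local Open Scope classical_set_scope.
Local Open Scope ring_scope.

(** Choose distinct indices [a], [b], [c] with [X a], [X b], [X c]
    infinite-dimensional. The form is a series, over blocks [l] with
    coefficients [2^-l], of finite sums
      [\sum_(j < N l) th l j * \prod_i f l i j (y i)],
    where the [th l j] lie in [{0, 1}].

    The forms [f l i j] come with vectors [x0 l i j] of norm at most [1] such
    that [f l i j (x0 l i j)] is bounded away from [0]. The Dvoretzky-Rogers
    lemma, applied to [X a], makes the vectors [x0 l a j] weakly 2-summable in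
    [j] uniformly in the size [N l]; applied to the duals of [X b] and [X c], it
    makes the forms weakly 2-summable there. By Cauchy-Schwarz in the
    coordinates [b] and [c] every block is then bounded independently of its
    size ([sum_term_le]), so the series converges to a continuous multilinear
    form for every choice of [th] ([block_form_multilinear],
    [block_form_continuous]).

    The domination is tested on multiples of the [x0 l i j]. A factor
    [(2^-l) `^ (p i)^-1] makes the blocks summable over [l]. For [i != a] the
    factor [N l `^ (- (p i)^-1)] makes a block of vectors [p i]-summable in
    norm. In the coordinate [a] a factor [N l `^ (- sigma)] with
    [sigma < (p a)^-1] suffices for weak [p a]-summability, thanks to weak
    2-summability ([weak_block_le]). This gain of a positive power of [N l]
    makes the diagonal terms of a large block as large as desired in
    [ell_q] ([exists_block_size]).

    The other terms of the series are not under control at the test points.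
    They are dealt with by the choice of [th]: averaging over the coefficients
    of one block shows that some choice of them produces at least a fixed
    fraction of the diagonal sum, whatever the remaining coefficients, and a
    gliding hump argument fixes the blocks successively ([gliding_hump]).

    The Dvoretzky-Rogers lemma follows from a comparison of determinants: among
    the linear maps from Euclidean space contractive for a norm [N], take one
    with almost maximal determinant; if, composed with [N], it were at most
    half the Euclidean norm on a subspace of small codimension, stretching the
    map on this subspace would increase the determinant too much. The forms are
    supplied by the Hahn-Banach theorem, obtained from minimal sublinear
    functionals. *)

Set Implicit Arguments.
Unset Strict Implicit.
Unset Printing Implicit Defensive.

(** * The Dvoretzky-Rogers lemma *)

Section DvoretzkyRogers.
Variable R : realType.

(** The square of the Euclidean norm of a row vector. *)
Definition sqn n (a : 'rV[R]_n) : R := (a *m a^T) 0 0.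

Lemma sqnE n (a : 'rV[R]_n) : sqn a = \sum_j a 0 j ^+ 2.
Proof. by rewrite /sqn mxE; apply: eq_bigr => j _; rewrite mxE expr2. Qed.

Lemma sqn_ge0 n (a : 'rV[R]_n) : 0 <= sqn a.
Proof. by rewrite sqnE; apply: sumr_ge0 => j _; rewrite sqr_ge0. Qed.

Lemma sqr_le_sqn n (a : 'rV[R]_n) j : a 0 j ^+ 2 <= sqn a.
Proof.
rewrite sqnE (bigD1 j) //= lerDl; apply: sumr_ge0 => i _.
by rewrite sqr_ge0.
Qed.

Lemma sqnZ n c (a : 'rV[R]_n) : sqn (c *: a) = c ^+ 2 * sqn a.
Proof. by rewrite /sqn linearZ /= -scalemxAl -scalemxAr !mxE; ring. Qed.

Lemma sqn_eq0 n (a : 'rV[R]_n) : sqn a = 0 -> a = 0.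
Proof.
move=> a0; apply/rowP => j; rewrite mxE; apply/eqP.
by rewrite -sqrf_eq0 eq_le sqr_ge0 andbT -a0 sqr_le_sqn.
Qed.

Lemma sqn_delta n (i : 'I_n) : sqn (delta_mx 0 i) = 1.
Proof.
rewrite sqnE (bigD1 i) //= mxE !eqxx expr1n big1 ?addr0 // => j ji.
by rewrite mxE eqxx (negbTE ji) expr0n.
Qed.

Lemma sqn_orthonormal n m (V : 'M[R]_(n, m)) (a : 'rV_n) :
  V *m V^T = 1%:M -> sqn (a *m V) = sqn a.
Proof. by move=> V1; rewrite /sqn trmx_mul mulmxA -(mulmxA a) V1 mulmx1. Qed.

(** For orthonormal rows, [V^T *m V] is the orthogonal projection onto their span.
    The identity is Sylvester's, through two factorizations of a block matrix. *)
Lemma det_sub_proj n m (V : 'M[R]_(n, m)) (t : R) : t != 0 ->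
  V *m V^T = 1%:M ->
  \det (t%:M - V^T *m V) = (1 - t^-1) ^+ n * t ^+ m.
Proof.
move=> t0 V1.
have E : block_mx 1%:M 0 V^T 1%:M *m block_mx 1%:M V 0 (t%:M - V^T *m V)
   = block_mx (1 - t^-1)%:M (t^-1 *: V) 0 1%:M *m block_mx 1%:M 0 V^T t%:M.
  rewrite !mulmx_block !mul1mx !mulmx1 !mul0mx !mulmx0 !addr0 !add0r.
  rewrite addrC subrK -scalemxAl V1 mul_mx_scalar scalerA mulfV // scale1r.
  by rewrite !scalemx1 -rmorphD /= subrK.
move/(congr1 determinant): E.
rewrite !det_mulmx det_lblock det_ublock det_ublock det_lblock.
by rewrite !det1 !det_scalar !mul1r !mulr1.
Qed.

Variables (m : nat) (N : 'rV[R]_m -> R) (D : R).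
Hypothesis N0 : forall a, 0 <= N a.
Hypothesis ND : forall a b, N (a + b) <= N a + N b.
Hypothesis NZ : forall c a, N (c *: a) = `|c| * N a.
Hypothesis N_coord : forall (a : 'rV[R]_m) j, `|a 0 j| <= D * N a.

(** [T] maps the Euclidean unit ball into the unit ball of [N]. *)
Definition euclid_contraction (T : 'M[R]_m) :=
  forall a, N (a *m T) ^+ 2 <= sqn a.

Lemma det_contraction_le T : euclid_contraction T ->
  `|\det T| <= \sum_(s : 'S_m) `|D| ^+ m.
Proof.
move=> hT.
have entry i j : `|T i j| <= `|D|.
  have /= := N_coord (row i T) j; rewrite mxE => /le_trans; apply.
  have := hT (delta_mx 0 i); rewrite -rowE sqn_delta.
  rewrite -[X in _ <= X -> _](expr1n _ 2%N) ler_sqr ?nnegrE // => N1.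
  apply: le_trans (ler_wpM2r (N0 _) (ler_norm D)) _.
  by rewrite -[leRHS]mulr1 ler_wpM2l.
apply: le_trans (ler_norm_sum _ _ _) _; apply: ler_sum => s _.
rewrite normrM normrX normrN1 expr1n mul1r normr_prod.
rewrite -[X in _ <= _ ^+ X]card_ord -prodr_const.
by apply: ler_prod => i _; rewrite normr_ge0 entry.
Qed.

Lemma exists_contraction : exists2 T, euclid_contraction T & 0 < `|\det T|.
Proof.
pose L := \sum_(i < m) N (delta_mx 0 i) + 1.
have L0 : 0 < L by rewrite ltr_pwDr // sumr_ge0.
exists (L^-1)%:M; last first.
  by rewrite det_scalar normr_gt0 expf_neq0 // invr_eq0 gt_eqF.
have Li0 : 0 <= L^-1 by rewrite invr_ge0 ltW.
move=> a; rewrite mul_mx_scalar NZ ger0_norm // mulrC.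
have : N a <= L * Num.sqrt (sqn a).
  rewrite {1}(row_sum_delta a).
  have Ns (I : Type) (r : seq I) (F : I -> 'rV[R]_m) :
      N (\sum_(i <- r) F i) <= \sum_(i <- r) N (F i).
    elim: r => [|i r IH].
      by rewrite !big_nil -(scale0r 0) NZ normr0 mul0r.
    by rewrite !big_cons; apply: le_trans (ND _ _) _; rewrite lerD2l.
  apply: le_trans (Ns _ _ _) _.
  rewrite /L mulrDl mulr_suml mul1r; apply: ler_wpDr; first exact: sqrtr_ge0.
  apply: ler_sum => i _; rewrite NZ mulrC; apply: ler_wpM2l => //.
  by rewrite -sqrtr_sqr ler_sqrt ?sqn_ge0 // sqr_le_sqn.
rewrite -ler_pdivrMl // mulrC => Na.
rewrite -(sqr_sqrtr (sqn_ge0 a)); apply: lerXn2r => //.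
  by rewrite nnegrE mulr_ge0.
by rewrite nnegrE sqrtr_ge0.
Qed.

(** The determinants being bounded, some contraction exceeds half of their
    supremum in absolute value. *)
Lemma exists_almost_max_contraction : exists T, euclid_contraction T /\
  0 < `|\det T| /\
  forall S, euclid_contraction S -> `|\det S| < 2 * `|\det T|.
Proof.
pose E := [set `|\det T| | T in [set T | euclid_contraction T]].
have [T0 hT0 dT0] := exists_contraction.
have hE : has_sup E.
  split; first by exists `|\det T0|, T0.
  exists (\sum_(s : 'S_m) `|D| ^+ m) => _ [T hT <-].
  exact: det_contraction_le.
have s0 : 0 < sup E.
  by apply: lt_le_trans dT0 _; apply: sup_upper_bound => //; exists T0.
have [_ [T hT <-] Tmax] : exists2 e, E e & sup E - sup E / 2 < e.
  by apply: sup_adherent => //; rewrite divr_gt0.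
exists T; split => //; split; first lra.
move=> S hS; have : `|\det S| <= sup E.
  by apply: sup_upper_bound => //; exists S.
lra.
Qed.

(** Where [b |-> N (b *m T)] is at most half the Euclidean norm, namely on the
    orthogonal complement of the rows of [V], [T] is multiplied by [3 / 2]; it
    is multiplied by [1 / 2] on the span of these rows. *)
Lemma contraction_stretch T n (V : 'M[R]_(n, m)) : euclid_contraction T ->
  V *m V^T = 1%:M ->
  (forall b, b *m V^T = 0 -> N (b *m T) ^+ 2 <= sqn b / 4) ->
  euclid_contraction (((3 / 2)%:M - V^T *m V) *m T).
Proof.
move=> hT V1 small a; rewrite mulmxA mulmxBr mul_mx_scalar mulmxA.
set b := a *m V^T *m V; pose c := a - b.
have cV : c *m V^T = 0.
  by rewrite /c /b mulmxBl -[X in _ - X]mulmxA V1 mulmx1 subrr.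
have -> : (3 / 2) *: a - b = 2^-1 *: b + (3 / 2) *: c.
  rewrite /c scalerBr addrCA; congr (_ + _).
  by rewrite -scalerBl -scaleN1r; congr (_ *: _); lra.
have bc : b *m c^T = 0.
  have Vc : V *m c^T = 0 by rewrite -[V]trmxK -trmx_mul cV trmx0.
  by rewrite /b -mulmxA Vc mulmx0.
have abc : sqn a = sqn b + sqn c.
  have -> : a = b + c by rewrite /c addrC subrK.
  have cb : c *m b^T = 0 by rewrite -[c]trmxK -trmx_mul bc trmx0.
  by rewrite /sqn linearD /= mulmxDl !mulmxDr bc cb add0r addr0 mxE.
have hb := hT b; have hc := small c cV; have hb0 := sqn_ge0 b.
have hc0 := sqn_ge0 c.
have /(_ (3 / 2) _) hN2 := NZ; have /(_ 2^-1 _) hN1 := NZ.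
have hN := ND ((2^-1 *: b) *m T) (((3 / 2) *: c) *m T).
rewrite -mulmxDl -!scalemxAl hN1 hN2 in hN.
rewrite abc; move: hN (N0 (b *m T)) (N0 (c *m T)) hb hc.
have -> : `|2^-1 : R| = 2^-1 by rewrite ger0_norm //; lra.
have -> : `|3 / 2 : R| = 3 / 2 by rewrite ger0_norm //; lra.
move: (N0 ((2^-1 *: b + (3 / 2) *: c) *m T)).
move: (N _) (N (b *m T)) (N (c *m T)) => z x y z0 zxy x0 y0 xb yc.
apply: (@le_trans _ _ ((2^-1 * x + 3 / 2 * y) ^+ 2)).
  by rewrite ler_sqr // nnegrE //; lra.
nra.
Qed.

(** In an [m]-dimensional normed space, if [3 * n <= m], there are [n] vectors of
    norm at least [1 / 2] that are the images of an orthonormal basis under a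
    contraction from [n]-dimensional Euclidean space. They are built as
    [row j V *m T], where [T] has almost maximal determinant and the rows of [V]
    are orthonormal and chosen one after the other. *)
Lemma dvoretzky_rogers n : (3 * n <= m)%N ->
  exists U : 'M[R]_(n, m), (forall a, N (a *m U) ^+ 2 <= sqn a) /\
    forall j, 2^-1 <= N (row j U).
Proof.
move=> nm; have [T [hT [T0 Tmax]]] := exists_almost_max_contraction.
suff H k : (k <= n)%N -> exists V : 'M[R]_(k, m), V *m V^T = 1%:M /\
    forall j, 2^-1 <= N (row j V *m T).
  have [V [V1 hV]] := H n (leqnn n); exists (V *m T); split.
    by move=> a; rewrite mulmxA -(sqn_orthonormal a V1).
  by move=> j; rewrite row_mul.
elim: k => [_|k IH kn].
  exists 0; split; last by case.
  by apply/matrixP; case.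
have [V [V1 hV]] := IH (ltnW kn).
have [[e [eV e1 eT]]|none] := pselect (exists e : 'rV[R]_m,
  [/\ e *m V^T = 0, sqn e = 1 & 2^-1 <= N (e *m T)]).
  suff : exists W : 'M[R]_(1 + k, m), W *m W^T = 1%:M /\
    forall j, 2^-1 <= N (row j W *m T) by [].
  exists (col_mx e V); split.
    rewrite tr_col_mx mul_col_row eV V1.
    have -> : V *m e^T = 0 by rewrite -[V]trmxK -trmx_mul eV trmx0.
    rewrite (_ : e *m e^T = 1%:M) -?scalar_mx_block //.
    by apply/matrixP => i j; rewrite !ord1 [LHS]e1 mxE.
  move=> j; case: (splitP j) => [i ji|i ji].
    have -> : j = lshift k i by apply: val_inj.
    by rewrite (ord1 i) -row_usubmx col_mxKu row_id.
  have -> : j = rshift 1 i by apply: val_inj.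
  by rewrite -row_dsubmx col_mxKd.
(* If no further row can be added, stretching [T] multiplies its determinant
   by [(1 / 2) ^ k * (3 / 2) ^ (m - k)], which is at least [2]. *)
exfalso.
have small b : b *m V^T = 0 -> N (b *m T) ^+ 2 <= sqn b / 4.
  move=> bV; have [b0|b0] := eqVneq (sqn b) 0.
    by rewrite b0 (sqn_eq0 b0) mul0mx -(scale0r 0) NZ normr0 !mul0r expr0n.
  have r0 : 0 < Num.sqrt (sqn b).
    by rewrite sqrtr_gt0 lt_neqAle eq_sym b0 sqn_ge0.
  rewrite leNgt; apply/negP => hb; apply: none.
  exists ((Num.sqrt (sqn b))^-1 *: b); split.
  - by rewrite -scalemxAl bV scaler0.
  - by rewrite sqnZ exprVn sqr_sqrtr ?sqn_ge0 // mulVf.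
  - rewrite -scalemxAl NZ ger0_norm ?invr_ge0 ?(ltW r0) //.
    rewrite ler_pdivlMl // -ler_sqr ?nnegrE ?mulr_ge0 ?invr_ge0 ?(ltW r0) //.
    by rewrite exprMn sqr_sqrtr ?sqn_ge0 //; lra.
have := Tmax _ (contraction_stretch hT V1 small).
rewrite det_mulmx normrM ltr_pM2r // det_sub_proj //. 
apply/negP; rewrite -leNgt.
rewrite ger0_norm; last by rewrite mulr_ge0 ?exprn_ge0 //; lra.
have mk : m = (k + 2 * k.+1 + (m - (k + 2 * k.+1)))%N.
  by rewrite subnKC //; lia.
rewrite mk !exprD mulrA mulrA -exprMn exprM.
rewrite (_ : (1 - (3 / 2)^-1) * (3 / 2) = 2^-1 :> R); last by field.
rewrite exprSr mulrA -exprMn.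
have : 1 <= (2^-1 * (3 / 2) ^+ 2 : R) ^+ k by apply: exprn_ege1; lra.
set u := _ ^+ k => u1.
have : 1 <= (3 / 2 : R) ^+ (m - (k + 2 * k.+1)) by apply: exprn_ege1; lra.
set v := _ ^+ _ => v1.
nra.
Qed.

End DvoretzkyRogers.

(** * The Hahn-Banach theorem *)

Section HahnBanach.
Variables (R : realType) (K : pzRingType) (io : {rmorphism R -> K}).
Variable V : lmodType K.

(** Sublinearity with respect to the real scalars, embedded in [K] by [io]. *)
Definition sublinear (p : V -> R) :=
  (forall x y, p (x + y) <= p x + p y) /\
  (forall t x, 0 <= t -> p (io t *: x) <= t * p x).

Lemma sublinear0 p : sublinear p -> p 0 = 0.
Proof.
move=> [pD pZ]; apply/eqP; rewrite eq_le; apply/andP; split.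
  by have := pZ 0 0 (lexx _); rewrite scaler0 mul0r.
by have := pD 0 0; rewrite addr0; lra.
Qed.

Lemma sublinearN p x : sublinear p -> - p (- x) <= p x.
Proof.
by move=> sp; have := sp.1 x (- x); rewrite subrr sublinear0 //; lra.
Qed.

Lemma sublinear_ge p t x : sublinear p -> 0 <= t -> t * p x <= p (io t *: x).
Proof.
move=> sp; rewrite le_eqVlt => /predU1P[<-|t0].
  by rewrite mul0r rmorph0 scale0r sublinear0.
have := sp.2 t^-1 (io t *: x); rewrite scalerA -rmorphM mulVf ?gt_eqF //.
by rewrite rmorph1 scale1r ler_pdivlMl // invr_ge0; apply; exact: ltW.
Qed.

Lemma inf_add_ge (A B : set R) c : A !=set0 -> B !=set0 ->
  (forall a b, A a -> B b -> c <= a + b) -> c <= inf A + inf B.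
Proof.
move=> A0 B0 h; rewrite -lerBlDl; apply: lb_le_inf => // b Bb.
rewrite lerBlDl addrC -lerBlDl; apply: lb_le_inf => // a Aa.
by rewrite lerBlDl addrC; exact: h.
Qed.

Lemma inf_mul_ge (A : set R) c t : A !=set0 -> 0 < t ->
  (forall a, A a -> c <= t * a) -> c <= t * inf A.
Proof.
move=> A0 t0 h; rewrite -ler_pdivrMl //; apply: lb_le_inf => // a Aa.
by rewrite ler_pdivrMl //; exact: h.
Qed.

(** The values whose infimum is the sublinear functional
    [x |-> inf_(t >= 0) (q (x + t y) - t q y)]; it lies below [q], and below
    [- q y] at [- y]. *)
Definition shift_values (q : V -> R) y x : set R :=
  [set q (x + io t *: y) - t * q y | t in [set t | 0 <= t]].

Definition sublinear_shift (q : V -> R) y x := inf (shift_values q y x).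

Lemma shift_values_n0 q y x : shift_values q y x !=set0.
Proof. by eexists; exists 0 => /=. Qed.

Lemma shift_lb q y x : sublinear q -> has_lbound (shift_values q y x).
Proof.
move=> sq; exists (- q (- x)) => _ [t /= t0 <-].
have := sq.1 (- x) (x + io t *: y); rewrite addKr.
by have := sublinear_ge y sq t0; lra.
Qed.

Lemma shift_le q y x t : sublinear q -> 0 <= t ->
  sublinear_shift q y x <= q (x + io t *: y) - t * q y.
Proof. by move=> sq t0; apply: ge_inf; [exact: shift_lb|exists t]. Qed.

Lemma shift_le_self q y x : sublinear q -> sublinear_shift q y x <= q x.
Proof.
move=> sq; have := shift_le y x sq (lexx 0).
by rewrite rmorph0 scale0r addr0 mul0r subr0.
Qed.

Lemma shift_sublinear q y : sublinear q -> sublinear (sublinear_shift q y).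
Proof.
move=> sq; split => [x z|t x].
  apply: inf_add_ge; [exact: shift_values_n0|exact: shift_values_n0|].
  move=> _ _ [t /= t0 <-] [s /= s0 <-].
  apply: le_trans (shift_le y (x + z) sq (addr_ge0 t0 s0)) _.
  rewrite rmorphD scalerDl addrACA.
  by have := sq.1 (x + io t *: y) (z + io s *: y); lra.
rewrite le_eqVlt => /predU1P[<-|t0].
  rewrite rmorph0 scale0r mul0r -(sublinear0 sq); exact: shift_le_self.
apply: inf_mul_ge => //; first exact: shift_values_n0.
move=> _ [s /= s0 <-].
apply: le_trans (shift_le y _ sq (mulr_ge0 (ltW t0) s0)) _.
rewrite rmorphM -scalerA -scalerDr.
by have := sq.2 t (x + io s *: y) (ltW t0); lra.
Qed.

(** Zorn's lemma: pointwise infima of chains are sublinear, being bounded below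
    by [x |-> - p (- x)]. *)
Lemma exists_minimal_sublinear p : sublinear p ->
  exists q, [/\ sublinear q, forall x, q x <= p x &
    forall r, sublinear r -> (forall x, r x <= q x) -> forall x, q x <= r x].
Proof.
move=> sp; pose P q := sublinear q /\ forall x, q x <= p x.
pose T := {q | P q}.
pose t0 : T := exist P p (conj sp (fun x => lexx (p x))).
pose le_T (q r : T) := `[< forall x, projT1 r x <= projT1 q x >].
have [|||q qmin] := @ZL_preorder T t0 le_T.
- by move=> q; apply/asboolP.
- move=> r q s /asboolP rq /asboolP qs; apply/asboolP => x.
  exact: le_trans (qs x) (rq x).
- move=> A Atot; have [[a Aa]|A0] := pselect (A !=set0); last first.
    by exists t0 => s As; exfalso; apply: A0; exists s.
  pose B x := [set projT1 q x | q in A].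
  have B0 x : B x !=set0 by exists (projT1 a x), a.
  have Blb x : has_lbound (B x).
    exists (- p (- x)) => _ [q Aq <-]; case: q Aq => q [sq qp] /= _.
    by have := sublinearN x sq; have := qp (- x); lra.
  have Ble q x : A q -> inf (B x) <= projT1 q x.
    by move=> Aq; apply: ge_inf => //; exists q.
  have sB : sublinear (fun x => inf (B x)).
    split => [x y|t x].
      apply: inf_add_ge => // _ _ [q Aq <-] [r Ar <-].
      have [/asboolP qr|/asboolP rq] := Atot _ _ Aq Ar.
        apply: le_trans (Ble _ _ Ar) _.
        have := (projT2 r).1.1 x y; have := qr x; rewrite /=; lra.
      apply: le_trans (Ble _ _ Aq) _.
      have := (projT2 q).1.1 x y; have := rq y; rewrite /=; lra.
    rewrite le_eqVlt => /predU1P[<-|t1].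
      rewrite rmorph0 scale0r mul0r; apply: le_trans (Ble _ _ Aa) _.
      by rewrite (sublinear0 (projT2 a).1).
    apply: inf_mul_ge => // _ [q Aq <-].
    by apply: le_trans (Ble _ _ Aq) _; apply: (projT2 q).1.2; exact: ltW.
  have Bp x : inf (B x) <= p x.
    exact: le_trans (Ble _ _ Aa) ((projT2 a).2 x).
  exists (exist P _ (conj sB Bp)) => q Aq; apply/asboolP => x /=; exact: Ble.
exists (projT1 q); split; [exact: (projT2 q).1|exact: (projT2 q).2|].
move=> r sr rq x.
have rp z : r z <= p z by exact: le_trans (rq z) ((projT2 q).2 z).
have := qmin (exist P r (conj sr rp)); rewrite /le_T => /(_ _)/asboolP; apply.
by apply/asboolP.
Qed.

(** A minimal sublinear functional [q] coincides with all its shifts, hence is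
    additive; starting from a shift of [p] secures the value at [x0]. *)
Lemma hahn_banach_real p x0 : sublinear p -> exists f : V -> R,
  [/\ forall x y, f (x + y) = f x + f y, forall t x, f (io t *: x) = t * f x,
      forall x, f x <= p x & p x0 <= f x0].
Proof.
move=> sp.
have [q [sq qp qmin]] := exists_minimal_sublinear (shift_sublinear x0 sp).
have qD x y : q (x + y) = q x + q y.
  apply/eqP; rewrite eq_le sq.1 /=.
  have := qmin _ (shift_sublinear y sq) (fun z => shift_le_self y z sq) x.
  move/le_trans => /(_ _ (shift_le y x sq ler01)).
  by rewrite rmorph1 scale1r mul1r; lra.
have q0 := sublinear0 sq.
have qN x : q (- x) = - q x.
  by apply/eqP; rewrite -addr_eq0 -qD addNr q0.
have qZ t x : 0 <= t -> q (io t *: x) = t * q x.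
  by move=> t0; apply/eqP; rewrite eq_le sq.2 //= sublinear_ge.
exists q; split => // [t x|x|].
- have [t0|t0] := leP 0 t; first exact: qZ.
  by rewrite -{1}[t]opprK rmorphN scaleNr qN qZ ?oppr_ge0 ?ltW // mulNr opprK.
- exact: le_trans (qp x) (shift_le_self _ _ sp).
- have := le_trans (qp (- x0)) (shift_le x0 (- x0) sp ler01).
  by rewrite rmorph1 scale1r mul1r addNr (sublinear0 sp) qN sub0r lerN2.
Qed.

End HahnBanach.

(** * Scalars and geometric series *)

Section Scalars.
Variables (R : realType) (k : scalar_kind).
Local Notation K := (scalar_field R k).

(** The embedding of the reals into the scalars. *)
Definition emb : R -> K :=
  match k return R -> scalar_field R k with
  | RealScalars => fun x : R => x
  | ComplexScalars => fun x : R => (x%:C)%C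
  end.

Lemma emb_is_zmod_morphism : zmod_morphism emb.
Proof. by rewrite /emb; case: k => x y //=; rewrite rmorphB. Qed.

Lemma emb_is_monoid_morphism : monoid_morphism emb.
Proof. by rewrite /emb; case: k; split => //= x y; rewrite rmorphM. Qed.

HB.instance Definition _ := GRing.isZmodMorphism.Build R K emb
  emb_is_zmod_morphism.
HB.instance Definition _ := GRing.isMonoidMorphism.Build R K emb
  emb_is_monoid_morphism.

Local Notation md := (@modulus R k).

Lemma norm_emb_modulus (z : K) : `|z| = emb (md z).
Proof. by rewrite /emb; move: z; case: k => z //=. Qed.

Lemma le_emb a b : (emb a <= emb b) = (a <= b).
Proof. by rewrite /emb; case: k => //=; rewrite lecR. Qed.

Lemma emb_inj : injective emb.
Proof.
by move=> a b ab; apply/eqP; rewrite eq_le -!le_emb ab lexx.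
Qed.

Lemma modulus_emb a : md (emb a) = `|a|.
Proof.
rewrite /emb; case: k => //=.
by rewrite expr0n /= addr0 sqrtr_sqr.
Qed.

Lemma modulus_ge0 z : 0 <= md z.
Proof. by rewrite -le_emb -norm_emb_modulus rmorph0. Qed.

Lemma modulusM z w : md (z * w) = md z * md w.
Proof. by apply: emb_inj; rewrite rmorphM /= -!norm_emb_modulus normrM. Qed.

Lemma modulusD z w : md (z + w) <= md z + md w.
Proof. by rewrite -le_emb rmorphD /= -!norm_emb_modulus ler_normD. Qed.

Lemma modulusN z : md (- z) = md z.
Proof. by apply: emb_inj; rewrite -!norm_emb_modulus normrN. Qed.

Lemma modulusB z w : md (z - w) <= md z + md w.
Proof. by rewrite -(modulusN w) modulusD. Qed.

Lemma modulus0 : md 0 = 0.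
Proof. by rewrite -(rmorph0 emb) modulus_emb normr0. Qed.

Lemma modulus1 : md 1 = 1.
Proof. by rewrite -(rmorph1 emb) modulus_emb normr1. Qed.

Lemma modulus_eq0 z : md z = 0 -> z = 0.
Proof.
by move=> z0; apply/eqP; rewrite -normr_eq0 norm_emb_modulus z0 rmorph0.
Qed.

Lemma modulus_sum (I : Type) (r : seq I) (F : I -> K) :
  md (\sum_(i <- r) F i) <= \sum_(i <- r) md (F i).
Proof.
elim: r => [|i r IH]; first by rewrite !big_nil modulus0.
by rewrite !big_cons; apply: le_trans (modulusD _ _) _; rewrite lerD2l.
Qed.

Lemma modulus_prod (I : Type) (r : seq I) (F : I -> K) :
  md (\prod_(i <- r) F i) = \prod_(i <- r) md (F i).
Proof. by apply: (big_morph md modulusM modulus1). Qed.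

(** Real and imaginary parts, the latter being zero for real scalars. *)
Definition re : K -> R :=
  match k return scalar_field R k -> R with
  | RealScalars => fun x : R => x
  | ComplexScalars => fun z : R[i] => complex.Re z
  end.

Definition im : K -> R :=
  match k return scalar_field R k -> R with
  | RealScalars => fun x : R => 0
  | ComplexScalars => fun z : R[i] => complex.Im z
  end.

Lemma reD z w : re (z + w) = re z + re w.
Proof. by rewrite /re; move: z w; case: k => // -[? ?] [? ?]. Qed.

Lemma imD z w : im (z + w) = im z + im w.
Proof.
by rewrite /im; move: z w; case: k => [? ?|[? ?] [? ?]] //; rewrite addr0.
Qed.

Lemma reZ a z : re (emb a * z) = a * re z.
Proof.
by rewrite /re /emb; move: z; case: k => // -[? ?] /=; rewrite mul0r subr0.
Qed.

Lemma imZ a z : im (emb a * z) = a * im z.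
Proof.
rewrite /im /emb; move: z; case: k => [?|[? ?]] /=; first by rewrite mulr0.
by rewrite mul0r addr0.
Qed.

Lemma re0 : re 0 = 0. Proof. by have := reD 0 0; rewrite addr0; lra. Qed.
Lemma im0 : im 0 = 0. Proof. by have := imD 0 0; rewrite addr0; lra. Qed.

Lemma sqr_modulus z : md z ^+ 2 = re z ^+ 2 + im z ^+ 2.
Proof.
rewrite /re /im; move: z; case: k => [z|[x y]] /=.
  by rewrite expr0n /= addr0 real_normK // num_real.
by rewrite sqr_sqrtr // addr_ge0 // sqr_ge0.
Qed.

Lemma le_norm_re z : `|re z| <= md z.
Proof.
rewrite -ler_sqr ?nnegrE ?modulus_ge0 // real_normK ?num_real // sqr_modulus.
by rewrite lerDl sqr_ge0.
Qed.

Lemma le_norm_im z : `|im z| <= md z.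
Proof.
rewrite -ler_sqr ?nnegrE ?modulus_ge0 // real_normK ?num_real // sqr_modulus.
by rewrite lerDr sqr_ge0.
Qed.

Lemma modulus_le_re_im z : md z <= `|re z| + `|im z|.
Proof.
rewrite -ler_sqr ?nnegrE ?modulus_ge0 ?addr_ge0 // sqr_modulus.
rewrite -(real_normK (num_real (re z))) -(real_normK (num_real (im z))).
have := normr_ge0 (re z); have := normr_ge0 (im z); nra.
Qed.

(** Duality between the two forms of weak 2-summability. Testing with real
    coefficients only costs a factor 2 over the complex numbers. *)
Lemma sum_sqr_modulus_le n (z : 'I_n -> K) (C : R) : 0 <= C ->
  (forall a : 'I_n -> R,
     md (\sum_j emb (a j) * z j) ^+ 2 <= C * \sum_j a j ^+ 2) ->
  \sum_j md (z j) ^+ 2 <= 2 * C.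
Proof.
move=> C0 h.
have part (f : K -> R) : (forall u v, f (u + v) = f u + f v) -> f 0 = 0 ->
    (forall a u, f (emb a * u) = a * f u) -> (forall u, `|f u| <= md u) ->
    \sum_j f (z j) ^+ 2 <= C.
  move=> fD f0 fZ fle; have := h (fun j => f (z j)).
  set w := \sum_j _; set S := \sum_j _.
  have fw : f w = S.
    by rewrite (big_morph f fD f0); apply: eq_bigr => j _; rewrite fZ expr2.
  have S0 : 0 <= S by apply: sumr_ge0 => j _; exact: sqr_ge0.
  have := fle w; rewrite fw ger0_norm // => Sw.
  move=> wS; have : S ^+ 2 <= C * S.
    by apply: le_trans wS; rewrite ler_sqr ?nnegrE // modulus_ge0.
  have [->//|S1] := eqVneq S 0; have : 0 < S by rewrite lt_neqAle eq_sym S1.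
  by move=> S2; rewrite expr2 ler_pM2r.
under eq_bigr do rewrite sqr_modulus.
rewrite big_split /=.
have := part im imD im0 imZ le_norm_im; have := part re reD re0 reZ le_norm_re.
lra.
Qed.

End Scalars.

Section GeometricSeries.
Variable R : realType.

Lemma exists_natr_ge (C : R) : exists i, C <= i%:R.
Proof.
exists (Num.bound `|C|); apply: le_trans (ler_norm _) _.
by apply: ltW; apply: archi_boundP.
Qed.

Lemma le0_geometric (x C : R) : (forall N, x <= C * 2^-1 ^+ N) -> x <= 0.
Proof.
move=> xC; rewrite leNgt; apply/negP => x0.
have [N hN] := exists_natr_ge (C / x).
have := xC N; rewrite exprVn ler_pdivlMr ?exprn_gt0 // mulrC.
rewrite -ler_pdivlMr //; move/le_trans => /(_ _ hN).
by rewrite -natrX ler_nat leqNgt ltn_expl.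
Qed.

Lemma real_geometric_series (z : nat -> R) (C : R) :
  (forall i, `|z i| <= C * 2^-1 ^+ i) ->
  exists s, forall N, `|s - \sum_(i < N) z i| <= C * 2 * 2^-1 ^+ N.
Proof.
move=> zC.
have C0 : 0 <= C by have := zC 0%N; rewrite expr0 mulr1; exact: le_trans.
have tail N l : \sum_(N <= i < N + l) `|z i| <= C * 2 * 2^-1 ^+ N.
  apply: (@le_trans _ _ (C * 2 * (2^-1 ^+ N - 2^-1 ^+ (N + l)))); last first.
    by rewrite ler_wpM2l ?mulr_ge0 // lerBlDr lerDl exprn_ge0 // invr_ge0.
  elim: l => [|l IH]; first by rewrite addn0 big_geq // subrr mulr0.
  rewrite addnS big_nat_recr ?leq_addr //=.
  apply: le_trans (lerD IH (zC _)) _; rewrite exprS le_eqVlt; apply/orP; left.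
  by apply/eqP; field.
have hc : cvgn (series z).
  apply: normed_cvg; apply: (@series_le_cvg _ _ (geometric C 2^-1)).
  - by move=> i; exact: normr_ge0.
  - by move=> i; rewrite /geometric /= mulr_ge0 // exprn_ge0 // invr_ge0.
  - by move=> i; exact: zC.
  - apply: is_cvg_geometric_series.
    by rewrite ger0_norm ?invr_ge0 // invf_lt1 // ltr1n.
exists (limn (series z)) => N; apply/ler_addgt0Pr => e e0.
have /cvgrPdist_lt/(_ e e0)[M _ hM] := hc.
have /= := hM (N + M)%N (leq_addl _ _); set s := limn _ => sM.
have -> : s - \sum_(i < N) z i =
    (s - series z (N + M)%N) + \sum_(N <= i < N + M) z i.
  rewrite /series /= (big_cat_nat (n := N)) //= ?leq_addr // big_mkord.
  by rewrite opprD addrA subrK.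
apply: le_trans (ler_normD _ _) _; rewrite addrC; apply: lerD; last exact: ltW.
exact: le_trans (ler_norm_sum _ _ _) (tail N M).
Qed.

Lemma scalar_geometric_series (k : scalar_kind) (z : nat -> scalar_field R k)
    (C : R) : (forall i, modulus (z i) <= C * 2^-1 ^+ i) ->
  exists s, forall N, modulus (s - \sum_(i < N) z i) <= C * 4 * 2^-1 ^+ N.
Proof.
move=> zC.
have [x hx] := @real_geometric_series (fun i => re (z i)) C
  (fun i => le_trans (le_norm_re _) (zC i)).
have [y hy] := @real_geometric_series (fun i => im (z i)) C
  (fun i => le_trans (le_norm_im _) (zC i)).
suff [s [sx sy]] : exists s : scalar_field R k, re s = x /\ im s = y.
  exists s => N; apply: le_trans (modulus_le_re_im _) _.
  have reN (u : scalar_field R k) : re (- u) = - re u.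
    by have := reD (- u) u; rewrite addNr re0; lra.
  have imN (u : scalar_field R k) : im (- u) = - im u.
    by have := imD (- u) u; rewrite addNr im0; lra.
  rewrite reD imD reN imN sx sy (big_morph (@re R k) (@reD R k) (@re0 R k)).
  rewrite (big_morph (@im R k) (@imD R k) (@im0 R k)).
  by have := hx N; have := hy N; lra.
case: k z zC hx hy => z zC hx hy; last by exists (x +i* y)%C.
exists x; split => //=; apply/eqP; rewrite eq_sym -normr_le0.
apply: (le0_geometric (C := C * 2)) => N.
by have := hy N; rewrite big1 // subr0.
Qed.

End GeometricSeries.

(** * Linear forms and weakly 2-summable families *)

Section Spaces.
Variables (R : realType) (k : scalar_kind).
Local Notation K := (scalar_field R k).
Local Notation md := (@modulus R k).
Local Notation emb := (@emb R k).

(** The norm of a vector as an element of [R]. *)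
Definition nrm (X : normedModType K) (x : X) : R := md `|x|.

(** Linear forms [X -> K] as plain functions. *)
Definition lform (X : normedModType K) (f : X -> K) :=
  forall a x y, f (a *: x + y) = a * f x + f y.

Section Norm.
Variable X : normedModType K.
Implicit Types x y : X.

Lemma emb_nrm x : emb (nrm x) = `|x|.
Proof. by rewrite /nrm -norm_emb_modulus normr_id. Qed.

Lemma nrm_ge0 x : 0 <= nrm x. Proof. exact: modulus_ge0. Qed.

Lemma nrmD x y : nrm (x + y) <= nrm x + nrm y.
Proof. by rewrite -(le_emb k) rmorphD /= !emb_nrm ler_normD. Qed.

Lemma nrmZ a x : nrm (a *: x) = md a * nrm x.
Proof.
apply: (@emb_inj R k); rewrite rmorphM /= !emb_nrm normrZ.
by rewrite -norm_emb_modulus.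
Qed.

Lemma nrm0 : nrm (0 : X) = 0.
Proof. by rewrite /nrm normr0 modulus0. Qed.

Lemma nrm_eq0 x : (nrm x == 0) = (x == 0).
Proof.
apply/eqP/eqP => [x0|->]; last exact: nrm0.
by apply/eqP; rewrite -normr_eq0 -emb_nrm x0 rmorph0.
Qed.

Lemma nrm_gt0 x : x != 0 -> 0 < nrm x.
Proof. by move=> x0; rewrite lt_neqAle eq_sym nrm_eq0 x0 nrm_ge0. Qed.

Lemma nrm_normalize x : x != 0 -> nrm (emb (nrm x)^-1 *: x) = 1.
Proof.
move=> /nrm_gt0 x0; rewrite nrmZ modulus_emb ger0_norm ?invr_ge0 ?nrm_ge0 //.
by rewrite mulVf // gt_eqF.
Qed.

Variable f : X -> K.
Hypothesis lf : lform f.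

Lemma lform0 : f 0 = 0.
Proof.
have := lf 1 0 0; rewrite scaler0 addr0 mul1r => h.
by apply: (addrI (f 0)); rewrite -h addr0.
Qed.

Lemma lformZ a x : f (a *: x) = a * f x.
Proof. by rewrite -[a *: x]addr0 lf lform0 addr0. Qed.

Lemma lformD x y : f (x + y) = f x + f y.
Proof. by rewrite -[x]scale1r lf mul1r scale1r. Qed.

Lemma lformB x y : f (x - y) = f x - f y.
Proof. by rewrite lformD -scaleN1r lformZ mulN1r. Qed.

Lemma lform_sum n (a : 'I_n -> K) (b : 'I_n -> X) :
  f (\sum_i a i *: b i) = \sum_i a i * f (b i).
Proof.
rewrite (big_morph f lformD lform0).
by apply: eq_bigr => i _; rewrite lformZ.
Qed.

End Norm.

End Spaces.

(** A real-linear functional [f] is the real part of [y |-> f y - i f (i y)]. *)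
Lemma exists_form_with_real_part (R : realType) (k : scalar_kind)
    (X : normedModType (scalar_field R k)) (f : X -> R) :
  (forall x y, f (x + y) = f x + f y) ->
  (forall t x, f (emb k t *: x) = t * f x) ->
  (forall x, `|f x| <= nrm x) ->
  exists g : X -> scalar_field R k, [/\ lform g, forall y, re (g y) = f y &
    forall y, `|im (g y)| <= nrm y].
Proof.
move=> fD fZ fabs.
have fN y : f (- y) = - f y.
  by rewrite -scaleN1r -(rmorph1 (emb k)) -rmorphN fZ mulN1r.
rewrite /nrm /emb in fZ fabs *; case: k X f fD fZ fabs fN => X f fD fZ fabs fN.
  exists f; split => //; first by move=> a y z; rewrite fD -(fZ a).
  by move=> y /=; rewrite normr0.
exists (fun y => (f y +i* (- f ('i%C *: y)))%C); split => //.
- move=> a y z.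
  have E : a *: y =
      ((complex.Re a)%:C)%C *: y + 'i%C *: (((complex.Im a)%:C)%C *: y).
    by rewrite {1}(complexE a) scalerDl scalerA.
  have iE : 'i%C *: (a *: y) =
      ((complex.Re a)%:C)%C *: ('i%C *: y) - ((complex.Im a)%:C)%C *: y.
    rewrite E scalerDr !scalerA; congr (_ + _); first by rewrite mulrC.
    by rewrite -expr2 sqr_i mulN1r scaleNr.
  have fi : f (a *: y) = complex.Re a * f y + complex.Im a * f ('i%C *: y).
    by rewrite E fD scalerA mulrC -scalerA !fZ.
  have fii : f ('i%C *: (a *: y)) =
      complex.Re a * f ('i%C *: y) - complex.Im a * f y.
    by rewrite iE fD fN !fZ.
  rewrite fD scalerDr fD fi fii; case: a {E iE fi fii} => a b /=.
  by congr (_ +i* _)%C; ring.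
- move=> y /=; rewrite normrN; apply: le_trans (fabs _) _.
  rewrite normrZ (_ : `|'i%C : R[i]| = 1) ?mul1r //.
  by apply/eqP; rewrite eq_complex /= expr0n expr1n add0r sqrtr1 !eqxx.
Qed.


Section Spaces.
Variables (R : realType) (k : scalar_kind).
Local Notation K := (scalar_field R k).
Local Notation md := (@modulus R k).
Local Notation emb := (@emb R k).

(** Hahn-Banach theorem. Bounding the real and imaginary parts separately costs
    the factor 2. *)
Lemma exists_norming_form (X : normedModType K) (x : X) :
  exists f : X -> K, [/\ lform f, forall y, md (f y) <= 2 * nrm y &
    nrm x <= md (f x)].
Proof.
have sn : sublinear emb (@nrm R k X).
  split; first exact: nrmD.
  by move=> t y t0; rewrite nrmZ modulus_emb ger0_norm.
have [f [fD fZ fle fx]] := hahn_banach_real x sn.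
have fN y : f (- y) = - f y.
  by rewrite -scaleN1r -(rmorph1 emb) -rmorphN fZ mulN1r.
have fabs y : `|f y| <= nrm y.
  rewrite ler_norml fle andbT lerNl -fN; apply: le_trans (fle _) _.
  by rewrite -scaleN1r nrmZ modulusN modulus1 mul1r.
have [g [lg reg img]] := exists_form_with_real_part fD fZ fabs.
exists g; split => //.
  move=> y; apply: le_trans (modulus_le_re_im _) _; rewrite reg.
  by have := fabs y; have := img y; lra.
  apply: le_trans (le_norm_re _); rewrite reg.
  exact: le_trans fx (ler_norm _).
Qed.

(** Biorthogonal systems in an infinite-dimensional space. *)
Lemma exists_biorthogonal (X : normedModType K) (n : nat) :
  infinite_dimensional X -> exists (b : nat -> X) (f : nat -> X -> K),
  [/\ forall i, lform (f i),
    forall i, exists C, forall y, md (f i y) <= C * nrm y &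
    forall i j, (i < n)%N -> (j < n)%N -> f i (b j) = (i == j)%:R].
Proof.
move=> infX; elim: n => [|n [b [f [lf bf fb]]]].
  exists (fun=> 0), (fun _ _ => 0); split => //.
    by move=> i a x y; rewrite mulr0 addr0.
  by move=> i; exists 0 => y; rewrite modulus0 mul0r.
have [x hx] : exists x, forall c : 'I_n -> K, x != \sum_(i < n) c i *: b i.
  apply: contrapT => h; apply: infX; exists n, (fun i => b i) => x.
  apply: contrapT => hx; apply: h; exists x => c; apply/eqP => xc.
  by apply: hx; exists c.
pose x' := x - \sum_(i < n) f i x *: b i.
have x'0 : x' != 0 by rewrite subr_eq0.
have fx' i : (i < n)%N -> f i x' = 0.
  move=> ni; rewrite /x' lformB // lform_sum // (bigD1 (Ordinal ni)) //= fb //.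
  rewrite eqxx mulr1 big1 ?addr0 ?subrr // => j ji.
  rewrite fb // (_ : (i == j) = false) ?mulr0 //.
  by apply/negP => /eqP ij; move/eqP: ji; apply; apply: val_inj.
have [g [lg gb gx]] := exists_norming_form x'.
have gx0 : g x' != 0.
  apply/eqP => g0; move: gx; rewrite g0 modulus0 leNgt => /negP; apply.
  exact: nrm_gt0.
pose h y := (g x')^-1 * (g y - \sum_(i < n) g (b i) * f i y).
have lh : lform h.
  move=> a y z; rewrite /h lg -mulrCA -mulrDr; congr (_ * _).
  rewrite mulrBr addrACA -opprD mulr_sumr -big_split /=; congr (_ - _).
  by apply: eq_bigr => i _; rewrite lf; ring.
have bh : exists C, forall y, md (h y) <= C * nrm y.
  have /choice[C hC] := bf.
  exists (md (g x')^-1 * (2 + \sum_(i < n) md (g (b i)) * C i)) => y.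
  rewrite /h modulusM -mulrA ler_wpM2l ?modulus_ge0 //.
  apply: le_trans (modulusB _ _) _; rewrite mulrDl; apply: lerD => //.
  apply: le_trans (modulus_sum _ _) _; rewrite mulr_suml; apply: ler_sum => i _.
  by rewrite modulusM -mulrA ler_wpM2l ?modulus_ge0.
exists (fun i => if i == n then x' else b i).
exists (fun i => if i == n then h else f i).
split; [by move=> i; case: eqP|by move=> i; case: eqP|].
move=> i j; rewrite !ltnS leq_eqVlt (leq_eqVlt j).
case/predU1P => [->|ni]; case/predU1P => [->|nj]; rewrite ?eqxx.
- by rewrite /h big1 ?subr0 ?mulVf // => l _; rewrite fx' ?mulr0.
- rewrite (ltn_eqF nj) (gtn_eqF nj) /h (bigD1 (Ordinal nj)) //= fb // eqxx mulr1.
  rewrite big1 ?addr0 ?subrr ?mulr0 // => l lj; rewrite fb //.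
  rewrite (_ : (nat_of_ord l == j) = false) ?mulr0 //.
  by apply/negP => /eqP ij; move/eqP: lj; apply; apply: val_inj.
- by rewrite (ltn_eqF ni) fx'.
- by rewrite (ltn_eqF ni) (ltn_eqF nj) fb.
Qed.


Lemma lform_biorthogonal_sum (X : normedModType K) m (b : nat -> X)
    (f : nat -> X -> K) (a : 'I_m -> R) (j : 'I_m) : lform (f j) ->
  (forall i l, (i < m)%N -> (l < m)%N -> f i (b l) = (i == l)%:R) ->
  f j (\sum_i emb (a i) *: b i) = emb (a j).
Proof.
move=> lf fb; rewrite lform_sum // (bigD1 j) //= fb // eqxx mulr1 big1 ?addr0 //.
move=> i ij; rewrite fb // (_ : (nat_of_ord j == i) = false) ?mulr0 //.
by rewrite eq_sym; apply/negbTE.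
Qed.

(** Dvoretzky-Rogers lemma in an infinite-dimensional space, applied to the span
    of a biorthogonal system: the biorthogonal forms bound the coordinates by
    the norm. *)
Lemma exists_weak2_vectors (X : normedModType K) n : infinite_dimensional X ->
  exists x : 'I_n -> X, (forall j, 2^-1 <= nrm (x j)) /\
    forall a : 'I_n -> R, nrm (\sum_j emb (a j) *: x j) ^+ 2 <= \sum_j a j ^+ 2.
Proof.
move=> infX; pose m := (3 * n)%N.
have [b [f [lf /choice[C hC] fb]]] := exists_biorthogonal m infX.
pose comb (a : 'rV[R]_m) := \sum_i emb (a 0 i) *: b i.
have combD a a' : comb (a + a') = comb a + comb a'.
  by rewrite -big_split; apply: eq_bigr => i _; rewrite mxE rmorphD scalerDl.
have combZ c a : comb (c *: a) = emb c *: comb a.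
  by rewrite scaler_sumr; apply: eq_bigr => i _; rewrite mxE rmorphM scalerA.
have [|||||U [Ule Uge]] := @dvoretzky_rogers R m (fun a => nrm (comb a))
    (\sum_(i < m) `|C i|) _ _ _ _ n.
- by move=> a; exact: nrm_ge0.
- by move=> a a'; rewrite combD nrmD.
- by move=> c a; rewrite combZ nrmZ modulus_emb.
- move=> a j; rewrite -(@modulus_emb R k).
  rewrite -(lform_biorthogonal_sum (a 0) (lf j) fb).
  apply: le_trans (hC _ _) _; apply: ler_wpM2r; first exact: nrm_ge0.
  apply: le_trans (ler_norm _) _; rewrite (bigD1 j) //= lerDl.
  by apply: sumr_ge0 => i _.
- by [].
exists (fun j => comb (row j U)); split => // a.
have -> : \sum_j emb (a j) *: comb (row j U) = comb ((\row_j a j) *m U).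
  have comb0 : comb 0 = 0.
    by rewrite /comb big1 // => i _; rewrite mxE rmorph0 scale0r.
  rewrite mulmx_sum_row (big_morph comb combD comb0).
  by apply: eq_bigr => j _; rewrite combZ mxE.
apply: le_trans (Ule _) _; rewrite sqnE le_eqVlt; apply/orP; left; apply/eqP.
by apply: eq_bigr => j _; rewrite mxE.
Qed.

(** Dvoretzky-Rogers lemma for the dual space. *)
Lemma exists_weak2_forms (X : normedModType K) n : infinite_dimensional X ->
  exists v : 'I_n -> X -> K, [/\ forall j, lform (v j),
    forall y, \sum_j md (v j y) ^+ 2 <= 2 * nrm y ^+ 2 &
    forall j, exists y, nrm y <= 1 /\ 4^-1 <= md (v j y)].
Proof.
move=> infX; pose m := (3 * n)%N.
have [b [f [lf /choice[C hC] fb]]] := exists_biorthogonal m infX.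
pose comb (a : 'rV[R]_m) y := \sum_i emb (a 0 i) * f i y.
have lcomb a : lform (comb a).
  move=> c x y; rewrite /comb mulr_sumr -big_split; apply: eq_bigr => i _ /=.
  by rewrite lf; ring.
have combD a a' y : comb (a + a') y = comb a y + comb a' y.
  by rewrite -big_split; apply: eq_bigr => i _; rewrite mxE rmorphD mulrDl.
have combZ c a y : comb (c *: a) y = emb c * comb a y.
  by rewrite mulr_sumr; apply: eq_bigr => i _; rewrite mxE rmorphM mulrA.
have comb0 y : comb 0 y = 0.
  by rewrite /comb big1 // => i _; rewrite mxE rmorph0 mul0r.
(* the norm of the dual space on the span of the [f i] *)
pose vals a := [set md (comb a y) | y in [set y | nrm y <= 1]].
pose N a := sup (vals a).
have vals0 a : vals a !=set0 by exists (md (comb a 0)), 0 => //=; rewrite nrm0.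
have valsub a : has_ubound (vals a).
  exists (\sum_i `|a 0 i| * `|C i|) => _ [y /= y1 <-].
  apply: le_trans (modulus_sum _ _) _; apply: ler_sum => i _.
  rewrite modulusM modulus_emb ler_wpM2l //; apply: le_trans (hC _ _) _.
  apply: le_trans (ler_wpM2r (nrm_ge0 _) (ler_norm _)) _.
  by rewrite -[leRHS]mulr1 ler_wpM2l.
have Nge a y : nrm y <= 1 -> md (comb a y) <= N a.
  by move=> y1; apply: sup_upper_bound; [split|exists y].
have Nle a c : (forall y, nrm y <= 1 -> md (comb a y) <= c) -> N a <= c.
  by move=> h; apply: sup_le_ub => // _ [y /= y1 <-]; exact: h.
have N0 a : 0 <= N a.
  by apply: le_trans (Nge a 0 _); rewrite ?modulus_ge0 // nrm0.
have opN a y : md (comb a y) <= N a * nrm y.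
  have [->|y0] := eqVneq y 0.
    by rewrite (lform0 (lcomb a)) modulus0 nrm0 mulr0.
  have := Nge a (emb (nrm y)^-1 *: y).
  rewrite nrm_normalize // lformZ // modulusM modulus_emb ger0_norm; last first.
    by rewrite invr_ge0 nrm_ge0.
  by rewrite ler_pdivrMl ?nrm_gt0 // mulrC; exact.
have NZle c a : N (c *: a) <= `|c| * N a.
  by apply: Nle => y y1; rewrite combZ modulusM modulus_emb ler_wpM2l // Nge.
have [||||U [Ule Uge]] := @dvoretzky_rogers R m N
    (\sum_(i < m) nrm (b i)) N0 _ _ _ n.
- move=> a a'; apply: Nle => y y1; rewrite combD.
  by apply: le_trans (modulusD _ _) _; apply: lerD; exact: Nge.
- move=> c a; apply/eqP; rewrite eq_le NZle /=.
  have [->|c0] := eqVneq c 0; first by rewrite normr0 mul0r.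
  have := NZle c^-1 (c *: a); rewrite scalerA mulVf // scale1r normfV.
  by rewrite ler_pdivlMl ?normr_gt0.
- move=> a j; rewrite -(@modulus_emb R k).
  have -> : emb (a 0 j) = comb a (b j).
    rewrite /comb (bigD1 j) //= fb // eqxx mulr1 big1 ?addr0 // => i ij.
    by rewrite fb // (_ : (nat_of_ord i == j) = false) ?mulr0 //; apply/negbTE.
  apply: le_trans (opN _ _) _; rewrite mulrC; apply: ler_wpM2r => //.
  rewrite (bigD1 j) //= lerDl; apply: sumr_ge0 => i _; exact: nrm_ge0.
- by [].
exists (fun j => comb (row j U)); split => // [y|j].
  apply: sum_sqr_modulus_le => [|a]; first exact: sqr_ge0.
  have -> : \sum_j emb (a j) * comb (row j U) y = comb ((\row_j a j) *m U) y.
    rewrite mulmx_sum_row.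
    rewrite (big_morph (comb^~ y) (fun a b => combD a b y) (comb0 y)).
    by apply: eq_bigr => j _; rewrite combZ mxE.
  have := opN ((\row_j a j) *m U) y; have := Ule (\row_j a j).
  have -> : sqn (\row_j a j) = \sum_j a j ^+ 2.
    by rewrite sqnE; apply: eq_bigr => j _; rewrite mxE.
  have := modulus_ge0 (comb ((\row_j a j) *m U) y); have := N0 ((\row_j a j) *m U).
  have := nrm_ge0 y.
  set c := md _; set M := N _; set r := nrm y; set S := \sum_j _.
  move=> r0 M0 c0 MS cMr.
  apply: (@le_trans _ _ ((M * r) ^+ 2)).
    by rewrite ler_sqr // nnegrE ?mulr_ge0.
  by rewrite exprMn mulrC ler_wpM2l ?sqr_ge0.
have : 4^-1 < N (row j U) by apply: lt_le_trans (Uge j); lra.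
move=> h; have [_ [y /= y1 <-] hy] := sup_gt (vals0 _) h.
by exists y; split => //; exact: ltW.
Qed.

(** Families of forms [f j] and vectors [x j] with uniform bounds above on both
    and a uniform bound below on [f j (x j)]. *)
Definition dual_pairing (X : normedModType K) n (f : 'I_n -> X -> K)
    (x : 'I_n -> X) :=
  forall j, [/\ lform (f j), forall y, md (f j y) <= 2 * nrm y, nrm (x j) <= 1 &
    4^-1 <= md (f j (x j))].

Lemma exists_pairing_weak2_vectors (X : normedModType K) n :
  infinite_dimensional X -> exists f x, @dual_pairing X n f x /\
    forall (g : X -> K) C, lform g -> 0 <= C ->
      (forall y, md (g y) <= C * nrm y) ->
      \sum_j md (g (x j)) ^+ 2 <= 2 * C ^+ 2.
Proof.
move=> /(exists_weak2_vectors n)[x [xge xle]].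
have /choice[f hf] : forall j, exists f : X -> K,
    [/\ lform f, forall y, md (f y) <= 2 * nrm y & nrm (x j) <= md (f (x j))].
  by move=> j; exact: exists_norming_form.
exists f, x; split => [j|g C lg C0 gC].
  have [lf fle fx] := hf j; split => //; last first.
    by apply: le_trans fx; apply: le_trans (xge j); lra.
  have := xle (fun i => (i == j)%:R); rewrite (bigD1 j) //= eqxx rmorph1 scale1r.
  rewrite big1 ?addr0; last by move=> i /negbTE->; rewrite rmorph0 scale0r.
  rewrite (bigD1 j) //= eqxx big1 ?addr0; last first.
    by move=> i /negbTE->; rewrite expr0n.
  rewrite expr1n => x1.
  by rewrite -(ler_pXn2r (n := 2)) ?nnegrE ?nrm_ge0 // expr1n.
apply: sum_sqr_modulus_le => [|a]; first exact: sqr_ge0.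
rewrite -lform_sum //; have := gC (\sum_j emb (a j) *: x j); have := xle a.
set S := \sum_j a j ^+ 2; set y := \sum_j _ => yS gy.
apply: (@le_trans _ _ ((C * nrm y) ^+ 2)).
  by rewrite ler_sqr // nnegrE ?mulr_ge0 ?nrm_ge0 ?modulus_ge0.
by rewrite exprMn ler_wpM2l ?sqr_ge0.
Qed.

Lemma exists_pairing_weak2_forms (X : normedModType K) n :
  infinite_dimensional X -> exists f x, @dual_pairing X n f x /\
    forall y, \sum_j md (f j y) ^+ 2 <= 2 * nrm y ^+ 2.
Proof.
move=> /(exists_weak2_forms n)[f [lf fle /choice[x hx]]].
exists f, x; split => // j; have [x1 fx] := hx j; split => // y.
rewrite -ler_sqr ?nnegrE ?modulus_ge0 ?mulr_ge0 ?nrm_ge0 // exprMn.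
have : md (f j y) ^+ 2 <= 2 * nrm y ^+ 2.
  apply: le_trans (fle y); rewrite (bigD1 j) //= lerDl.
  by apply: sumr_ge0 => i _; exact: sqr_ge0.
have := sqr_ge0 (nrm y); lra.
Qed.

Lemma exists_pairing (X : normedModType K) n : (exists x : X, x != 0) ->
  exists f x, @dual_pairing X n f x.
Proof.
move=> [x x0]; have [f [lf fle fx]] := exists_norming_form (emb (nrm x)^-1 *: x).
exists (fun=> f), (fun=> emb (nrm x)^-1 *: x) => j; split => //.
  by rewrite nrm_normalize.
by apply: le_trans fx; rewrite nrm_normalize //; lra.
Qed.

End Spaces.

(** * The gliding hump *)

Section GlidingHump.
Variable R : realType.
Implicit Types th : nat -> nat -> bool.

(** The coefficient arrays [th] and [th'] coincide on the blocks below [M]. *)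
Definition agree_below M th th' :=
  forall k j, (k < M)%N -> th k j = th' k j.

Lemma sum_flip_ge (n : nat) (i : 'I_n) (f : {ffun 'I_n -> bool} -> R) (d : R) :
  (forall s s' : {ffun 'I_n -> bool}, s i != s' i ->
     (forall j, j != i -> s j = s' j) -> d <= f s + f s') ->
  \sum_(s : {ffun 'I_n -> bool}) d / 2 <= \sum_s f s.
Proof.
move=> h; pose flip (s : {ffun 'I_n -> bool}) := [ffun j => (j == i) (+) s j].
have flipK : involutive flip.
  by move=> s; apply/ffunP => j; rewrite !ffunE addbA addbb.
have -> : \sum_s f s = (\sum_s (f s + f (flip s))) / 2.
  have E : \sum_s f s = \sum_s f (flip s) by exact: reindex_inj (inv_inj flipK).
  rewrite big_split /= -E.
  lra.
rewrite -mulr_suml ler_pM2r ?invr_gt0 //; apply: ler_sum => s _.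
apply: h => [|j ji]; rewrite ffunE; first by rewrite eqxx; case: (s i).
by rewrite (negbTE ji).
Qed.

(** The index set is divided into blocks, the [k]-th one having size [n k]. The
    quantity [G th k j] depends on a coefficient array [th]; its values at two
    arrays that differ exactly at [(k, j)] add up to at least [d k j], and it
    depends little on the coefficients of remote blocks. *)
Variables (n : nat -> nat) (G : (nat -> nat -> bool) -> nat -> nat -> R).
Variables (d : nat -> nat -> R) (q : R).
Hypothesis q0 : 0 < q.
Hypothesis G0 : forall th k j, 0 <= G th k j.
Hypothesis d0 : forall k j, 0 <= d k j.
Hypothesis Gflip : forall th th' k j, (j < n k)%N -> th k j != th' k j ->
  (forall k' j', (k', j') != (k, j) -> th k' j' = th' k' j') ->
  d k j <= G th k j + G th' k j.
Hypothesis Gcont : forall k j e, 0 < e -> exists M, forall th th',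
  agree_below M th th' -> G th k j <= G th' k j + e.
Hypothesis dbig : forall k, k%:R <= \sum_(j < n k) d k j `^ q.

(** Averaging over the coefficients of the block [k]: the two [j]-th values
    obtained by flipping the [j]-th coefficient add up to at least [d k j], so
    one of them is at least half of it. *)
Lemma exists_good_block th k : exists th',
  (forall k' j, k' != k -> th' k' j = th k' j) /\
  k%:R / 2 / 2 `^ q <= \sum_(j < n k) G th' k j `^ q.
Proof.
pose ext (s : {ffun 'I_(n k) -> bool}) k' j :=
  if k' == k then (if insub j is Some i then s i else false) else th k' j.
have extk (s : {ffun 'I_(n k) -> bool}) (j : 'I_(n k)) : ext s k j = s j.
  by rewrite /ext eqxx valK.
suff [s hs] : exists s, k%:R / 2 / 2 `^ q <= \sum_(j < n k) G (ext s) k j `^ q.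
  by exists (ext s); split => // k' j kk'; rewrite /ext (negbTE kk').
apply: contrapT => none.
have : \sum_s \sum_(j < n k) G (ext s) k j `^ q <
    \sum_(s : {ffun 'I_(n k) -> bool}) k%:R / 2 / 2 `^ q.
  apply: ltr_sum; last first.
    move=> s _; rewrite ltNge; apply/negP => h; apply: none; by exists s.
  by apply/hasP; exists [ffun=> false] => //; rewrite mem_index_enum.
apply/negP; rewrite -leNgt exchange_big /=.
apply: (@le_trans _ _ (\sum_(j < n k) \sum_(s : {ffun 'I_(n k) -> bool})
    (d k j / 2) `^ q / 2)).
  rewrite exchange_big /=; apply: ler_sum => s _.
  rewrite -mulr_suml mulrAC ler_pM2r ?invr_gt0 // ler_pdivrMr ?powR_gt0 //.
  apply: le_trans (dbig k) _; rewrite mulr_suml; apply: ler_sum => j _.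
  by rewrite -powRM ?divr_ge0 // divfK.
apply: ler_sum => j _; apply: (@sum_flip_ge _ j) => s s' sj ss'.
have : d k j <= G (ext s) k j + G (ext s') k j.
  apply: Gflip => //; first by rewrite !extk.
  move=> k' j'; rewrite /ext; have [->|//] := eqVneq k' k.
  rewrite xpair_eqE eqxx /= => jj'; case: insubP => // i _ ij.
  by apply: ss'; apply: contraNneq jj' => <-; rewrite ij.
have [h1|h1] := leP (d k j / 2) (G (ext s) k j) => h.
  apply: ler_wpDr; first exact: powR_ge0.
  by apply: ge0_ler_powR => //; rewrite ?nnegrE ?divr_ge0 // ltW.
apply: ler_wpDl; first exact: powR_ge0.
by apply: ge0_ler_powR => //; rewrite ?nnegrE ?divr_ge0 ?(ltW q0) //; lra.
Qed.

(** The coefficients below [M] can be continued by finitely many blocks so that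
    one block sum exceeds [C] whatever comes after. *)
Lemma gliding_step th M C : exists th' M', [/\ (M < M')%N,
  agree_below M th th' & exists k, forall th'', agree_below M' th' th'' ->
    C <= \sum_(j < n k) G th'' k j `^ q].
Proof.
have [k0 k0C] : exists k0, C * 2 `^ q * 2 `^ q * 2 <= k0%:R.
  exact: exists_natr_ge.
pose k := (k0 + M)%N; have [th' [th'E th'k]] := exists_good_block th k.
have /choice[m hm] : forall j : 'I_(n k), exists m, forall th'',
    agree_below m th' th'' -> G th' k j / 2 <= G th'' k j.
  move=> j; have [u0|u0] := eqVneq (G th' k j) 0.
    by exists 0%N => th'' _; rewrite u0 mul0r.
  have [|m hm] := @Gcont k j (G th' k j / 2).
    by rewrite divr_gt0 // lt_neqAle eq_sym u0 G0.
  by exists m => th'' /hm; lra.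
exists th', (M.+1 + \max_j m j)%N; split; first by rewrite addSn ltnS leq_addr.
  move=> k' j k'M; rewrite th'E // neq_ltn; apply/orP; left.
  by rewrite (leq_trans k'M) // leq_addl.
exists k => th'' hth; apply: (@le_trans _ _ (\sum_(j < n k) (G th' k j / 2) `^ q)).
  rewrite (_ : \sum_(j < n k) _ = (\sum_(j < n k) G th' k j `^ q) / 2 `^ q).
    rewrite ler_pdivlMr ?powR_gt0 //; apply: le_trans th'k.
    rewrite ler_pdivlMr ?powR_gt0 // ler_pdivlMr //.
    by apply: le_trans k0C _; rewrite ler_nat leq_addr.
  rewrite mulr_suml; apply: eq_bigr => j _.
  by rewrite powRM ?invr_ge0 // -powRN -powR_inv1 // -powRrM mulN1r.
apply: ler_sum => j _; apply: ge0_ler_powR; rewrite ?nnegrE ?divr_ge0 ?(ltW q0) //.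
apply: hm => k' j' k'm; apply: hth; apply: (leq_trans k'm).
by apply: (leq_trans (leq_bigmax j)); rewrite leq_addl.
Qed.

(** The signs are fixed block by block; what is gained on a block survives any
    later choice. *)
Lemma gliding_hump : exists th, forall C, exists k,
  C <= \sum_(j < n k) G th k j `^ q.
Proof.
have /choice[f hf] : forall w : (nat -> nat -> bool) * nat * nat,
    exists w' : (nat -> nat -> bool) * nat, [/\ (w.1.2 < w'.2)%N,
      agree_below w.1.2 w.1.1 w'.1 & exists k, forall th'',
        agree_below w'.2 w'.1 th'' -> w.2%:R <= \sum_(j < n k) G th'' k j `^ q].
  move=> [[th M] i]; have [th' [M' h]] := gliding_step th M i%:R.
  by exists (th', M').
pose fix st i := if i is i'.+1 then f (st i', i') else ((fun _ _ => false), 0%N).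
have stM i : (i <= (st i).2)%N.
  by elim: i => //= i IH; have [h _ _] := hf (st i, i); exact: leq_ltn_trans IH h.
have stmono i i' : (i <= i')%N ->
    ((st i).2 <= (st i').2)%N /\ agree_below (st i).2 (st i).1 (st i').1.
  move=> /subnK <-; elim: (i' - i)%N => [|l [IH1 IH2]] //=.
  have [/= h1 h2 _] := hf (st (l + i)%N, (l + i)%N); split.
    exact: leq_trans IH1 (ltnW h1).
  by move=> k j kM; rewrite IH2 // h2 //; exact: leq_trans IH1.
pose th k j := (st k.+1).1 k j.
have hth i : agree_below (st i).2 (st i).1 th.
  move=> k j kM; rewrite /th.
  have [ik|ki] := leqP i k.+1; first by rewrite (stmono _ _ ik).2.
  by rewrite -(stmono _ _ (ltnW ki)).2 // stM.
exists th => C.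
have [i iC] := exists_natr_ge C.
have [_ _ [k hk]] := hf (st i, i); exists k; apply: le_trans iC _.
exact: hk (hth i.+1).
Qed.

End GlidingHump.

(** * Double series and power estimates *)

Section PairSums.
Variable R : realType.
Local Open Scope ereal_scope.

(** Flattening a double sequence along a bijection [nat -> nat * nat]. *)
Lemma nneseries_pair (e : nat -> nat * nat) (G : nat -> nat -> \bar R) :
  set_bij [set: nat] [set: nat * nat] e -> (forall k j, 0 <= G k j) ->
  \sum_(0 <= m <oo) G (e m).1 (e m).2 =
  \sum_(0 <= k <oo) \sum_(0 <= j <oo) G k j.
Proof.
move=> be G0; rewrite nneseries_esumT //.
rewrite -(reindex_esum _ _ e (fun u => G u.1 u.2) be).
rewrite nneseries_esumT; last by move=> k; exact: nneseries_ge0.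
under [RHS]eq_esum do rewrite nneseries_esumT //.
rewrite esum_esum // (_ : _ `*`` _ = setT) //.
by apply/seteqP; split => // -[].
Qed.

Lemma sum_block (n : nat) (G : nat -> R) : (forall j, (0 <= G j)%R) ->
  (forall j, (n <= j)%N -> G j = 0%R) ->
  \sum_(0 <= j <oo) (G j)%:E = (\sum_(j < n) G j)%:E.
Proof.
move=> G0 Gn; rewrite (nneseries_split 0 n); last by move=> j _; rewrite lee_fin.
rewrite eseries0; last by move=> j nj _; rewrite Gn.
by rewrite adde0 big_mkord sumEFin.
Qed.

Lemma block_sums_lty (e : nat -> nat * nat) (n : nat -> nat)
    (G : nat -> nat -> R) (C : R) :
  set_bij [set: nat] [set: nat * nat] e -> (forall k j, (0 <= G k j)%R) ->
  (forall k j, (n k <= j)%N -> G k j = 0%R) ->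
  (forall k, (\sum_(j < n k) G k j <= C * 2^-1 ^+ k)%R) ->
  \sum_(0 <= m <oo) (G (e m).1 (e m).2)%:E < +oo.
Proof.
move=> be G0 Gn GC.
rewrite (nneseries_pair (G := fun k j => (G k j)%:E) be); last first.
  by move=> k j; rewrite lee_fin.
apply: (@le_lt_trans _ _ (C * 2)%:E); last exact: ltry.
apply: lime_le.
  by apply: is_cvg_nneseries => k _ _; apply: nneseries_ge0 => j _ _; rewrite lee_fin.
apply: nearW => K; under eq_bigr do rewrite (sum_block (G0 _) (Gn _)).
rewrite sumEFin lee_fin big_mkord.
apply: (@le_trans _ _ (C * 2 * (1 - 2^-1 ^+ K)))%R; last first.
  have C0 : (0 <= C)%R.
    by have := GC 0%N; rewrite expr0 mulr1; apply: le_trans; exact: sumr_ge0.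
  have x0 : (0 <= 2^-1 ^+ K :> R)%R by rewrite exprn_ge0 // invr_ge0.
  by have := mulr_ge0 C0 x0; lra.
elim: K => [|K IH]; first by rewrite big_ord0 expr0 subrr mulr0.
rewrite big_ord_recr /=; apply: le_trans (lerD IH (GC K)) _.
by rewrite exprS le_eqVlt; apply/orP; left; apply/eqP; field.
Qed.

Lemma block_sums_bounded (e : nat -> nat * nat) (n : nat -> nat)
    (G : nat -> nat -> R) :
  set_bij [set: nat] [set: nat * nat] e -> (forall k j, (0 <= G k j)%R) ->
  \sum_(0 <= m <oo) (G (e m).1 (e m).2)%:E < +oo ->
  exists C, forall k, (\sum_(j < n k) G k j <= C)%R.
Proof.
move=> be G0; rewrite (nneseries_pair (G := fun k j => (G k j)%:E) be); last first.
  by move=> k j; rewrite lee_fin.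
have S0 k : 0 <= \sum_(0 <= j <oo) (G k j)%:E.
  by apply: nneseries_ge0 => j _ _; rewrite lee_fin.
set S := \sum_(0 <= k <oo) _ => Soo.
exists (fine S) => k; rewrite -lee_fin fineK; last first.
  by rewrite ge0_fin_numE // /S; apply: nneseries_ge0 => l _ _.
rewrite -sumEFin; apply: le_trans (_ : \sum_(0 <= j <oo) (G k j)%:E <= _).
  rewrite -(big_mkord predT (fun j => (G k j)%:E)).
  by apply: nneseries_lim_ge => j _ _; rewrite lee_fin.
apply: le_trans (nneseries_lim_ge k.+1 (fun l _ _ => S0 l)).
by rewrite big_nat_recr //= leeDr // sume_ge0.
Qed.

End PairSums.

Section PowerArithmetic.
Variable R : realType.

Lemma prod_powR (I : finType) (x : R) (b : I -> R) : 0 < x ->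
  \prod_i x `^ b i = x `^ (\sum_i b i).
Proof.
move=> x0; rewrite (big_morph (powR x) (id1 := 1) (op1 := *%R)) ?powRr0 //.
by move=> r s; rewrite powRD //; apply/implyP => _; rewrite gt_eqF.
Qed.

(** The right-hand side is a positive constant times [N `^ (q * delta)]. *)
Lemma exists_block_size (q delta c D : R) : 0 < q -> 0 < delta -> 0 < c ->
  exists N, (0 < N)%N /\
    D <= N%:R * (c * N%:R `^ (- (q^-1 - delta))) `^ q.
Proof.
move=> q0 d0 c0; set r := (D / c `^ q).
have [N hN] := exists_natr_ge (`|r| `^ (q * delta)^-1 + 1).
have N1 : 1 <= N%:R :> R by apply: le_trans hN; rewrite lerDr powR_ge0.
have N0 : 0 < N%:R :> R by apply: lt_le_trans N1.
exists N; split; first by rewrite -(ltr_nat R).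
rewrite powRM ?(ltW c0) ?powR_ge0 // -powRrM mulrCA -{1}[N%:R]powRr1 ?(ltW N0) //.
rewrite -powRD; last by apply/implyP => _; rewrite gt_eqF.
rewrite (_ : 1 + - (q^-1 - delta) * q = q * delta); last first.
  by field; rewrite gt_eqF.
rewrite mulrC -ler_pdivrMr ?powR_gt0 //; apply: le_trans (ler_norm _) _.
have -> : `|D / c `^ q| = (`|r| `^ (q * delta)^-1) `^ (q * delta).
  by rewrite -powRrM mulVf ?powRr1 // gt_eqF // mulr_gt0.
apply: ge0_ler_powR.
- by rewrite mulr_ge0 // ltW.
- by rewrite nnegrE powR_ge0.
- by rewrite nnegrE ltW.
- by apply: le_trans hN; rewrite lerDl.
Qed.

(** Three exponents [b] for which scaling by [N `^ (- b)] bounds the [p]-th power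
    sum of [N] numbers of [[0, 1]] independently of [N], the last two under a
    bound on the sum of squares. For [b = 2^-1] the [p]-th powers are at most the
    first powers, which the arithmetic-geometric mean inequality controls. *)
Lemma block_weak_sum_le N (p b : R) (t : 'I_N -> R) : (0 < N)%N -> 1 <= p ->
  (forall j, 0 <= t j <= 1) ->
  [\/ b = p^-1,
      [/\ b = 0, 2 <= p & \sum_j t j ^+ 2 <= 1] |
      b = 2^-1 /\ \sum_j t j ^+ 2 <= 1] ->
  \sum_j (N%:R `^ (- b) * t j) `^ p <= 2.
Proof.
move=> N0 p1 t01; have p0 : 0 < p by apply: lt_le_trans p1.
have N1 : 0 < N%:R :> R by rewrite ltr0n.
have sumN : \sum_(j < N) N%:R^-1 = 1 :> R.
  by rewrite sumr_const card_ord -[_ *+ N]mulr_natr mulVf ?gt_eqF.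
case=> [->|[-> p2 ht]|[-> ht]].
- apply: (@le_trans _ _ (\sum_(j < N) N%:R^-1)); last by rewrite sumN ler1n.
  apply: ler_sum => j _; have /andP[t0 t1] := t01 j.
  rewrite powRM ?powR_ge0 // -powRrM mulNr mulVf ?gt_eqF // powRN powRr1 ?(ltW N1) //.
  rewrite -[leRHS]mulr1 ler_wpM2l ?invr_ge0 ?(ltW N1) //.
  apply: (@le_trans _ _ (1 `^ p)); last by rewrite powR1.
  by apply: ge0_ler_powR; rewrite ?nnegrE // ltW.
- apply: le_trans (_ : 1 <= 2); last by rewrite ler1n.
  apply: le_trans ht; apply: ler_sum => j _; have /andP[t0 t1] := t01 j.
  rewrite oppr0 powRr0 mul1r -powR_mulrn //.
  move: t0; rewrite le_eqVlt => /predU1P[<-|t0].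
    by rewrite !powR0 // gt_eqF.
  by apply: ger_powR => //; rewrite t0.
- rewrite (_ : 2 = 1 + 1 :> R) //; apply: le_trans (lerD ht (lexx 1)).
  rewrite -[X in _ <= _ + X]sumN -big_split /=.
  apply: ler_sum => j _; have /andP[t0 t1] := t01 j.
  set u := N%:R `^ (- 2^-1).
  have u2 : u ^+ 2 = N%:R^-1.
    by rewrite -powR_mulrn ?powR_ge0 // -powRrM mulNr mulVf // powRN powRr1 ?(ltW N1).
  have u0 : 0 < u by rewrite powR_gt0.
  have u1 : u <= 1.
    rewrite -(@expr_le1 _ 2%N) ?(ltW u0) // u2 invf_le1 // ler1n //.
  rewrite -u2; apply: (@le_trans _ _ (u * t j)); last by nra.
  have : 0 <= u * t j by rewrite mulr_ge0 // ltW.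
  rewrite le_eqVlt => /predU1P[<-|ut0]; first by rewrite powR0 // gt_eqF.
  rewrite -[leRHS]powRr1 ?(ltW ut0) //; apply: ger_powR => //.
  by rewrite ut0 mulr_ile1 // ltW.
Qed.

End PowerArithmetic.

(** * The multilinear form attached to a choice of coefficients *)

Section BlockFamily.
Variables (R : realType) (k : scalar_kind).
Local Notation K := (scalar_field R k).
Local Notation md := (@modulus R k).

(** [N] forms [f j] and vectors [x j] that pair uniformly, the forms being
    weakly 2-summable if [wf] holds, and the vectors if [wx] holds. *)
Definition block_family (X : normedModType K) N (wf wx : bool)
    (f : nat -> X -> K) (x : nat -> X) :=
  [/\ forall j, lform (f j), forall j y, md (f j y) <= 2 * nrm y,
      forall j, nrm (x j) <= 1, forall j, (j < N)%N -> 4^-1 <= md (f j (x j)) &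
      (wf -> forall y, \sum_(j < N) md (f j y) ^+ 2 <= 2 * nrm y ^+ 2) /\
      (wx -> forall (g : X -> K) C, lform g -> 0 <= C ->
         (forall y, md (g y) <= C * nrm y) ->
         \sum_(j < N) md (g (x j)) ^+ 2 <= 2 * C ^+ 2)].

Lemma exists_block_family (X : normedModType K) N (wf wx : bool) :
  (exists x : X, x != 0) -> (wf || wx -> infinite_dimensional X) ->
  ~~ (wf && wx) -> exists f x, @block_family X N wf wx f x.
Proof.
move=> X0 infX wfx.
suff [f [x [fx [hf hx]]]] : exists f x, @dual_pairing _ _ X N f x /\
    ((wf -> forall y, \sum_(j < N) md (f j y) ^+ 2 <= 2 * nrm y ^+ 2) /\
     (wx -> forall (g : X -> K) C, lform g -> 0 <= C ->
       (forall y, md (g y) <= C * nrm y) ->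
       \sum_(j < N) md (g (x j)) ^+ 2 <= 2 * C ^+ 2)).
  exists (fun j y => if insub j is Some i then f i y else 0).
  exists (fun j => if insub j is Some i then x i else 0).
  split.
  - move=> j; case: insubP => [i _ _|_] a u v; first by have [+ _ _ _] := fx i.
    by rewrite mulr0 addr0.
  - move=> j y; case: insubP => [i _ _|_]; first by have [_ + _ _] := fx i.
    by rewrite modulus0 mulr_ge0 // nrm_ge0.
  - move=> j; case: insubP => [i _ _|_]; first by have [_ _ + _] := fx i.
    by rewrite nrm0.
  - move=> j jN; rewrite insubT /=; by have [_ _ _ +] := fx (Ordinal jN).
  - split=> [/hf h y|/hx h g C lg C0 gC].
      by under eq_bigr do rewrite valK; exact: h.
    by under eq_bigr do rewrite valK; exact: h.
case: wf wx infX wfx => -[] //= infX _.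
- have [f [x [fx h]]] := exists_pairing_weak2_forms N (infX isT).
  by exists f, x; split => //; split.
- have [f [x [fx h]]] := exists_pairing_weak2_vectors N (infX isT).
  by exists f, x; split => //; split.
- by have [f [x fx]] := exists_pairing N X0; exists f, x.
Qed.

End BlockFamily.

Section Construction.
Variables (R : realType) (k : scalar_kind) (n : nat).
Local Notation K := (scalar_field R k).
Local Notation md := (@modulus R k).
Local Notation emb := (@emb R k).
Variable X : 'I_n -> completeNormedModType K.
Variables (N : nat -> nat) (f : nat -> forall i, nat -> X i -> K) (b c : 'I_n).
Arguments f : clear implicits.
Hypothesis bc : b != c.
Hypothesis lf : forall l i j, lform (f l i j).
Hypothesis f_le : forall l i j y, md (f l i j y) <= 2 * nrm y.
Hypothesis f_weak2 : forall l i y, i \in [:: b; c] ->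
  \sum_(j < N l) md (f l i j y) ^+ 2 <= 2 * nrm y ^+ 2.

Implicit Types (y : forall i, X i) (th : nat -> nat -> bool).

(** The terms of the series: elementary products of forms; weighted sums of
    these over the block [l], of size [N l], with coefficients in [{0, 1}]; and
    partial sums of blocks. *)
Definition form_term l j y : K := \prod_i f l i j (y i).

Definition form_block th l y : K :=
  emb (2^-1 ^+ l) * \sum_(j < N l) (th l j)%:R * form_term l j y.

Definition form_partial th m y : K := \sum_(l < m) form_block th l y.

(** A common bound of [1] and of the norms of the coordinates of [y]. *)
Definition size_bound y : R := 1 + \sum_i nrm (y i).

(** Bound for the sums over a block when the coordinates have norm at most [M],
    provided [1 <= M]. It is not homogeneous, but a bound on bounded sets
    suffices. *)
Definition block_bound (M : R) : R := 2 * M ^+ 2 * (2 * M) ^+ n.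

Lemma size_bound_ge1 y : 1 <= size_bound y.
Proof. by rewrite lerDl; apply: sumr_ge0 => i _; exact: nrm_ge0. Qed.

Lemma nrm_le_size_bound y i : nrm (y i) <= size_bound y.
Proof.
rewrite /size_bound (bigD1 i) //= addrCA lerDl addr_ge0 //.
by apply: sumr_ge0 => l _; exact: nrm_ge0.
Qed.

Lemma block_bound_ge0 M : 0 <= M -> 0 <= block_bound M.
Proof. by move=> M0; rewrite !mulr_ge0 ?exprn_ge0 // mulr_ge0. Qed.

Lemma block_bound_le M M' : 0 <= M -> M <= M' -> block_bound M <= block_bound M'.
Proof.
move=> M0 MM'; have M'0 := le_trans M0 MM'; rewrite /block_bound.
apply: ler_pM; rewrite ?mulr_ge0 ?exprn_ge0 ?mulr_ge0 //.
  by rewrite ler_wpM2l // lerXn2r.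
by apply: lerXn2r; rewrite ?nnegrE ?mulr_ge0 // ler_wpM2l.
Qed.

(** By Cauchy-Schwarz in the two coordinates carrying weakly 2-summable forms,
    the bound does not depend on the number of terms of the block. *)
Lemma sum_term_le l y :
  \sum_(j < N l) md (form_term l j y) <= block_bound (size_bound y).
Proof.
set M := size_bound y; have M1 : 1 <= M := size_bound_ge1 y.
have M0 : 0 <= M by lra.
have T j : md (form_term l j y) <=
    (md (f l b j (y b)) ^+ 2 + md (f l c j (y c)) ^+ 2) / 2 * (2 * M) ^+ n.
  rewrite /form_term modulus_prod (bigD1 b) //= (bigD1 c) ?(eq_sym c) //= mulrA.
  have P : \prod_(i | (i != b) && (i != c)) md (f l i j (y i)) <= (2 * M) ^+ n.
    rewrite big_mkcond /= -[X in _ <= _ ^+ X]card_ord -prodr_const.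
    apply: ler_prod => i _; case: ifP => _; last by rewrite ler01 /=; lra.
    rewrite modulus_ge0 /=; apply: le_trans (f_le _ _ _) _.
    by rewrite ler_wpM2l // nrm_le_size_bound.
  apply: ler_pM => //; first by rewrite mulr_ge0 ?modulus_ge0.
    by apply: prodr_ge0 => i _; exact: modulus_ge0.
  by have := sqr_ge0 (md (f l b j (y b)) - md (f l c j (y c))); nra.
apply: (@le_trans _ _ (\sum_(j < N l) (md (f l b j (y b)) ^+ 2 +
    md (f l c j (y c)) ^+ 2) / 2 * (2 * M) ^+ n)); first exact: ler_sum.
rewrite -mulr_suml ler_wpM2r ?exprn_ge0 ?mulr_ge0 // -mulr_suml big_split /=.
have hM i : nrm (y i) ^+ 2 <= M ^+ 2.
  by apply: lerXn2r; rewrite ?nnegrE ?nrm_ge0 // nrm_le_size_bound.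
have := f_weak2 l (y b) (mem_head _ _).
have := f_weak2 l (y c) (mem_last b [:: c]).
have := hM b; have := hM c; lra.
Qed.

Lemma block_le th l y :
  md (form_block th l y) <= block_bound (size_bound y) * 2^-1 ^+ l.
Proof.
rewrite /form_block modulusM modulus_emb ger0_norm ?exprn_ge0 ?invr_ge0 // mulrC.
rewrite ler_wpM2r ?exprn_ge0 ?invr_ge0 //.
apply: le_trans (modulus_sum _ _) _; apply: le_trans (sum_term_le l y).
apply: ler_sum => j _; rewrite modulusM -[leRHS]mul1r.
by rewrite ler_wpM2r ?modulus_ge0 //; case: (th l j); rewrite ?modulus1 ?modulus0.
Qed.

Lemma block_form_exists th y : exists s, forall m,
  md (s - form_partial th m y) <= block_bound (size_bound y) * 4 * 2^-1 ^+ m.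
Proof.
exact: (@scalar_geometric_series R k (fun l => form_block th l y) _
  (block_le th ^~ y)).
Qed.

(** The [n]-linear form with coefficients [th], as the limit of the partial
    sums. *)
Definition block_form th y : K := projT1 (cid (block_form_exists th y)).

Lemma block_form_partial_le th y m :
  md (block_form th y - form_partial th m y) <=
  block_bound (size_bound y) * 4 * 2^-1 ^+ m.
Proof. by rewrite /block_form; case: cid. Qed.

Lemma term_dfwith l j y i a u v : form_term l j (dfwith y i (a *: u + v)) =
  a * form_term l j (dfwith y i u) + form_term l j (dfwith y i v).
Proof.
have E w : form_term l j (dfwith y i w) =
    f l i j w * \prod_(i' | i' != i) f l i' j (y i').
  rewrite /form_term (bigD1 i) //= dfwithin; congr (_ * _).
  by apply: eq_bigr => i' ii'; rewrite dfwithout // eq_sym.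
by rewrite !E lf; ring.
Qed.

Lemma partial_dfwith th m y i a u v :
  form_partial th m (dfwith y i (a *: u + v)) =
  a * form_partial th m (dfwith y i u) + form_partial th m (dfwith y i v).
Proof.
rewrite /form_partial mulr_sumr -big_split; apply: eq_bigr => l _ /=.
rewrite /form_block mulrCA -mulrDr; congr (_ * _).
rewrite mulr_sumr -big_split; apply: eq_bigr => j _ /=.
by rewrite term_dfwith; ring.
Qed.

Lemma block_form_multilinear th :
  multilinear (block_form th : (forall i, X i) -> K^o).
Proof.
move=> i y a u v.
suff : md (block_form th (dfwith y i (a *: u + v)) -
    (a * block_form th (dfwith y i u) + block_form th (dfwith y i v))) <= 0.
  move=> h; apply/eqP; rewrite -subr_eq0; apply/eqP; apply: modulus_eq0.
  by apply/eqP; rewrite eq_le h modulus_ge0.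
set w1 := dfwith _ _ (_ + _); set w2 := dfwith _ _ u; set w3 := dfwith _ _ v.
pose C w := block_bound (size_bound w) * 4.
apply: (le0_geometric (C := C w1 + md a * C w2 + C w3)) => m.
have -> : block_form th w1 - (a * block_form th w2 + block_form th w3) =
    (block_form th w1 - form_partial th m w1) -
    a * (block_form th w2 - form_partial th m w2) -
    (block_form th w3 - form_partial th m w3).
  by rewrite [form_partial th m w1]partial_dfwith; ring.
apply: le_trans (modulusB _ _) _; rewrite !mulrDl; apply: lerD; last first.
  exact: block_form_partial_le.
apply: le_trans (modulusB _ _) _; apply: lerD; first exact: block_form_partial_le.
by rewrite modulusM -mulrA ler_wpM2l ?modulus_ge0 // block_form_partial_le.
Qed.

End Construction.

Section Continuity.
Variables (R : realType) (k : scalar_kind).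
Local Notation K := (scalar_field R k).
Local Notation md := (@modulus R k).
Local Notation emb := (@emb R k).

Lemma emb_gt0 a : 0 < a -> 0 < emb a.
Proof.
move=> a0; rewrite lt_neqAle eq_sym (fmorph_eq0 emb) gt_eqF //=.
by rewrite -(rmorph0 emb) le_emb ltW.
Qed.

Lemma emb_modulus_gt0 (e : K) : 0 < e -> emb (md e) = e.
Proof. by move=> e0; rewrite -norm_emb_modulus gtr0_norm. Qed.

Lemma bounded_lform_continuous (X : normedModType K) (g : X -> K) (C : R) :
  lform g -> (forall y, md (g y) <= C * nrm y) -> continuous (g : X -> K^o).
Proof.
move=> lg gC y; apply/cvgrPdist_le => e e0.
have C0 : 0 < `|C| + 1 by rewrite ltr_pwDr.
have eC : 0 < e / emb (`|C| + 1).
  by rewrite divr_gt0 // emb_gt0.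
near=> t; rewrite -(lformB lg) norm_emb_modulus.
apply: (@le_trans _ _ (emb ((`|C| + 1) * nrm (y - t)))).
  rewrite le_emb; apply: le_trans (gC _) _; rewrite ler_wpM2r ?nrm_ge0 //.
  by apply: le_trans (ler_norm _) _; rewrite lerDl.
rewrite rmorphM /= emb_nrm mulrC -ler_pdivlMr; last first.
  exact: emb_gt0.
near: t; exact: cvgr_dist_le.
Unshelve. all: by end_near. Qed.

Lemma continuous_scalar_mull (T : topologicalType) (a : K) (F : T -> K^o) :
  continuous F -> continuous ((fun y => a * F y) : T -> K^o).
Proof. by move=> cF y; apply: cvgM; [exact: cvg_cst|exact: cF]. Qed.

Lemma continuous_scalar_sum (T : topologicalType) (I : Type) (r : seq I)
    (F : I -> T -> K^o) : (forall i, continuous (F i)) ->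
  continuous ((fun y => \sum_(i <- r) F i y) : T -> K^o).
Proof.
move=> cF y; elim: r => [|i r IH].
  by under eq_fun do rewrite big_nil; exact: cvg_cst.
under eq_fun do rewrite big_cons.
by apply: cvgD => //; exact: cF.
Qed.

Lemma continuous_scalar_prod (T : topologicalType) (I : Type) (r : seq I)
    (F : I -> T -> K^o) : (forall i, continuous (F i)) ->
  continuous ((fun y => \prod_(i <- r) F i y) : T -> K^o).
Proof.
move=> cF y; elim: r => [|i r IH].
  by under eq_fun do rewrite big_nil; exact: cvg_cst.
under eq_fun do rewrite big_cons.
by apply: cvgM => //; exact: cF.
Qed.

Lemma linear_continuous_bound (X : normedModType K) (phi : {linear X -> K^o}) :
  continuous phi -> exists2 C, 0 <= C & forall y, md (phi y) <= C * nrm y.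
Proof.
move=> /linear_bounded_continuous/linear_boundedP/pinfty_ex_gt0[r r0 hr].
exists (md r) => [|y]; first exact: modulus_ge0.
have := hr y; rewrite norm_emb_modulus -emb_nrm -{1}(emb_modulus_gt0 r0).
by rewrite -rmorphM /= le_emb.
Qed.

End Continuity.

Section FormContinuity.
Variables (R : realType) (k : scalar_kind) (n : nat).
Local Notation K := (scalar_field R k).
Local Notation md := (@modulus R k).
Local Notation emb := (@emb R k).
Variable X : 'I_n -> completeNormedModType K.
Variables (N : nat -> nat) (f : nat -> forall i, nat -> X i -> K) (b c : 'I_n).
Arguments f : clear implicits.
Hypothesis bc : b != c.
Hypothesis lf : forall l i j, lform (f l i j).
Hypothesis f_le : forall l i j y, md (f l i j y) <= 2 * nrm y.
Hypothesis f_weak2 : forall l i y, i \in [:: b; c] ->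
  \sum_(j < N l) md (f l i j y) ^+ 2 <= 2 * nrm y ^+ 2.
Local Notation form := (block_form bc f_le f_weak2).

Lemma exists_geometric_le (C e : R) : 0 < e -> exists m, C * 2^-1 ^+ m <= e.
Proof.
move=> e0; apply: contrapT => h.
have : e <= 0; last by rewrite leNgt e0.
apply: (le0_geometric (C := C)) => m; rewrite leNgt; apply/negP => he.
by apply: h; exists m; exact: ltW.
Qed.

Lemma partial_continuous th m :
  continuous (@form_partial R k n X N f th m : prod_topology X -> K^o).
Proof.
apply: (@continuous_scalar_sum _ _ (prod_topology X)) => l.
apply: (@continuous_scalar_mull _ _ (prod_topology X)).
apply: (@continuous_scalar_sum _ _ (prod_topology X)) => j.
apply: (@continuous_scalar_mull _ _ (prod_topology X)).
apply: (@continuous_scalar_prod _ _ (prod_topology X) _ _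
  (fun i (y : prod_topology X) => f l i j (y i))) => i y.
apply: (@continuous_comp (prod_topology X) (X i) K^o (@proj _ X i) (f l i j)).
  exact: proj_continuous.
exact: (bounded_lform_continuous (lf l j) (f_le l j)).
Qed.

(** The partial sums are continuous and converge uniformly on bounded sets. *)
Lemma block_form_continuous th : continuous (form th : prod_topology X -> K^o).
Proof.
move=> y; apply/(@cvgrPdist_le _ _ _ (nbhs (y : prod_topology X))) => e e0.
have e'0 : 0 < md e.
  rewrite lt_neqAle modulus_ge0 andbT eq_sym; apply/eqP => /modulus_eq0 e1.
  by move: e0; rewrite e1 ltxx.
have e3 : 0 < emb (md e / 3) by rewrite emb_gt0 // divr_gt0.
have [m hm] := @exists_geometric_le (block_bound n (size_bound y + n%:R) * 4)
  (md e / 3) (divr_gt0 e'0 (ltr0n R 3)).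
near=> t.
have small i : nrm (t i) <= nrm (y i) + 1.
  have : `|y i - t i| <= 1.
    move: i; near: t; apply: filter_forall => i.
    have /cvgrPdist_le/(_ 1 ltr01) := @proj_continuous _ X i y; apply.
    exact: (@nbhs_filter (prod_topology X)).
  rewrite -(rmorph1 emb) -emb_nrm le_emb => h; rewrite -[t i](subKr (y i)).
  apply: le_trans (nrmD _ _) _; rewrite lerD2l; apply: le_trans h.
  by rewrite -scaleN1r nrmZ modulusN modulus1 mul1r.
have size_t : size_bound t <= size_bound y + n%:R.
  rewrite /size_bound -addrA lerD2l -[n in n%:R]card_ord -sumr_const -big_split.
  by apply: ler_sum => i _; exact: small.
have close : md (form_partial N f th m y - form_partial N f th m t) <= md e / 3.
  rewrite -(le_emb k) -norm_emb_modulus; near: t.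
  by have /cvgrPdist_le/(_ _ e3) := @partial_continuous th m y.
have tail w : size_bound w <= size_bound y + n%:R ->
    md (form th w - form_partial N f th m w) <= md e / 3.
  move=> hw; apply: le_trans (block_form_partial_le _ _ _ _ _ _) _.
  apply: le_trans hm; rewrite ler_wpM2r ?exprn_ge0 ?invr_ge0 // ler_wpM2r //.
  by apply: block_bound_le hw; apply: le_trans (size_bound_ge1 _).
rewrite norm_emb_modulus -(emb_modulus_gt0 e0) le_emb.
have -> : form th y - form th t = (form th y - form_partial N f th m y) +
    (form_partial N f th m y - form_partial N f th m t) -
    (form th t - form_partial N f th m t).
  by ring.
apply: le_trans (modulusB _ _) _.
have := modulusD (form th y - form_partial N f th m y)
  (form_partial N f th m y - form_partial N f th m t).
have := tail t size_t; have := tail y; rewrite lerDl ler0n => /(_ isT).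
lra.
Unshelve. all: by end_near. Qed.

End FormContinuity.

(** * Failure of domination *)

Section Divergence.
Variables (R : realType) (k : scalar_kind) (n : nat).
Local Notation K := (scalar_field R k).
Local Notation md := (@modulus R k).
Local Notation emb := (@emb R k).
Variable X : 'I_n -> completeNormedModType K.
Variables (N : nat -> nat) (f : nat -> forall i, nat -> X i -> K) (b c : 'I_n).
Arguments f : clear implicits.
Hypothesis bc : b != c.
Hypothesis f_le : forall l i j y, md (f l i j y) <= 2 * nrm y.
Hypothesis f_weak2 : forall l i y, i \in [:: b; c] ->
  \sum_(j < N l) md (f l i j y) ^+ 2 <= 2 * nrm y ^+ 2.
Local Notation form := (block_form bc f_le f_weak2).
Implicit Types (y : forall i, X i) (th : nat -> nat -> bool).

Lemma partial_flip th th' l j m y : (l < m)%N -> (j < N l)%N ->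
  th l j != th' l j ->
  (forall l' j', (l', j') != (l, j) -> th l' j' = th' l' j') ->
  md (form_partial N f th m y - form_partial N f th' m y) =
  2^-1 ^+ l * md (form_term f l j y).
Proof.
move=> lm jN thj th_eq; rewrite /form_partial -sumrB (bigD1 (Ordinal lm)) //=.
rewrite big1 ?addr0; last first.
  move=> l' ll'; apply/eqP; rewrite subr_eq0; apply/eqP.
  congr (_ * _); apply: eq_bigr => j' _; rewrite th_eq // xpair_eqE.
  by apply/nandP; left; apply: contra ll' => /eqP ll'; apply/eqP/val_inj.
rewrite /form_block -mulrBr modulusM modulus_emb ger0_norm ?exprn_ge0 ?invr_ge0 //.
congr (_ * _); rewrite -sumrB (bigD1 (Ordinal jN)) //= big1 ?addr0; last first.
  move=> j' jj'; rewrite th_eq ?subrr // xpair_eqE eqxx /=.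
  by apply: contra jj' => /eqP jj'; apply/eqP/val_inj.
rewrite -mulrBl modulusM.
case: (th l j) (th' l j) thj => -[] //= _.
  by rewrite subr0 modulus1 mul1r.
by rewrite sub0r modulusN modulus1 mul1r.
Qed.

(** Changing one coefficient changes the value by the corresponding term up to
    sign. *)
Lemma block_form_flip th th' l j y : (j < N l)%N -> th l j != th' l j ->
  (forall l' j', (l', j') != (l, j) -> th l' j' = th' l' j') ->
  2^-1 ^+ l * md (form_term f l j y) <= md (form th y) + md (form th' y).
Proof.
move=> jN thj th_eq; rewrite -subr_le0.
set B := block_bound n (size_bound y) * 4.
have B0 : 0 <= B.
  rewrite mulr_ge0 // block_bound_ge0 //.
  by apply: le_trans (size_bound_ge1 _); rewrite ler01.
apply: (le0_geometric (C := 2 * B)) => m.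
have e0 : (2^-1 : R) ^+ (l.+1 + m) <= 2^-1 ^+ m.
  rewrite exprD ler_piMl ?exprn_ge0 ?invr_ge0 //.
  by rewrite exprn_ile1 ?invr_ge0 // invf_le1 // ler1n.
have h1 := block_form_partial_le bc f_le f_weak2 th y (l.+1 + m)%N.
have h2 := block_form_partial_le bc f_le f_weak2 th' y (l.+1 + m)%N.
rewrite -/B in h1 h2.
have e1 := ler_wpM2l B0 e0.
rewrite -(@partial_flip th th' l j (l.+1 + m)) ?leq_addr //.
set P := form_partial N f th _ y; set P' := form_partial N f th' _ y.
have -> : P - P' =
    (form th y - form th' y) - ((form th y - P) - (form th' y - P')).
  by ring.
have := modulusB (form th y - form th' y) ((form th y - P) - (form th' y - P')).
have := modulusB (form th y) (form th' y).
have := modulusB (form th y - P) (form th' y - P').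
rewrite -/P -/P' in h1 h2; lra.
Qed.

Lemma block_form_agree th th' m y : agree_below m th th' ->
  md (form th y) <=
  md (form th' y) + 2 * (block_bound n (size_bound y) * 4) * 2^-1 ^+ m.
Proof.
move=> th_eq.
have h1 := block_form_partial_le bc f_le f_weak2 th y m.
have h2 := block_form_partial_le bc f_le f_weak2 th' y m.
have E : form_partial N f th m y = form_partial N f th' m y.
  apply: eq_bigr => l _; congr (_ * _); apply: eq_bigr => j _.
  by rewrite th_eq.
have -> : form th y = form th' y + ((form th y - form_partial N f th m y) -
    (form th' y - form_partial N f th' m y)) by rewrite E; ring.
apply: le_trans (modulusD _ _) _; rewrite lerD2l.
by apply: le_trans (modulusB _ _) _; lra.
Qed.

Lemma exists_unbounded_form (x : nat -> forall i, nat -> X i) (q : R) : 0 < q ->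
  (forall l, l%:R <=
     \sum_(j < N l) (2^-1 ^+ l * md (form_term f l j (fun i => x l i j))) `^ q) ->
  exists th, forall C, exists l,
    C <= \sum_(j < N l) md (form th (fun i => x l i j)) `^ q.
Proof.
move=> q0 big; apply: (@gliding_hump R N
  (fun th l j => md (form th (fun i => x l i j)))
  (fun l j => 2^-1 ^+ l * md (form_term f l j (fun i => x l i j)))) => //.
- by move=> th l j; exact: modulus_ge0.
- by move=> l j; rewrite mulr_ge0 ?modulus_ge0 // exprn_ge0 // invr_ge0.
- by move=> th th' l j jN thj th_eq; exact: block_form_flip.
- move=> l j e e0.
  have [m hm] := exists_geometric_le
    (2 * (block_bound n (size_bound (fun i => x l i j)) * 4)) e0.
  exists m => th th' /block_form_agree h; apply: le_trans (h _) _.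
  by rewrite lerD2l.
Qed.

End Divergence.

Section WeakSummability.
Variables (R : realType) (k : scalar_kind).
Local Notation K := (scalar_field R k).
Local Notation md := (@modulus R k).
Local Notation emb := (@emb R k).

(** The vectors of a block of size [N], scaled by [s `^ p^-1 * N `^ (- b)]: their
    images under a form [g] have a [p]-th power sum at most a multiple of [s] that
    does not depend on [N]. *)
Lemma weak_block_le (X : normedModType K) N (p b s C : R) (x : nat -> X)
    (g : X -> K) : (0 < N)%N -> 1 <= p -> 0 < s -> 0 <= C -> lform g ->
  (forall y, md (g y) <= C * nrm y) -> (forall j, nrm (x j) <= 1) ->
  [\/ b = p^-1,
      [/\ b = 0, 2 <= p & \sum_(j < N) md (g (x j)) ^+ 2 <= 2 * C ^+ 2] |
      b = 2^-1 /\ \sum_(j < N) md (g (x j)) ^+ 2 <= 2 * C ^+ 2] ->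
  \sum_(j < N) md (g (emb (s `^ p^-1 * N%:R `^ (- b)) *: x j)) `^ p <=
  2 * (2 * C + 1) `^ p * s.
Proof.
move=> N0 p1 s0 C0 lg gC x1 hb; have p0 : 0 < p by apply: lt_le_trans p1.
set D := 2 * C + 1; have D0 : 0 < D by rewrite /D; lra.
pose t (j : 'I_N) := md (g (x j)) / D.
have t0 j : 0 <= t j by rewrite divr_ge0 ?modulus_ge0 // ltW.
have E (j : 'I_N) : md (g (emb (s `^ p^-1 * N%:R `^ (- b)) *: x j)) `^ p =
    D `^ p * s * (N%:R `^ (- b) * t j) `^ p.
  rewrite lformZ // modulusM modulus_emb ger0_norm ?mulr_ge0 ?powR_ge0 //.
  have -> : s `^ p^-1 * N%:R `^ (- b) * md (g (x j)) =
      D * s `^ p^-1 * (N%:R `^ (- b) * t j).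
    by rewrite /t; field; rewrite gt_eqF.
  rewrite powRM; last 2 first.
  - by rewrite mulr_ge0 ?powR_ge0 ?(ltW D0).
  - by apply: mulr_ge0 => //; exact: powR_ge0.
  rewrite powRM ?powR_ge0 ?(ltW D0) // -powRrM mulVf ?gt_eqF // powRr1 //.
  exact: ltW.
rewrite (eq_bigr _ (fun j _ => E j)).
rewrite -mulr_sumr mulrC -[leRHS]mulrA ler_wpM2r ?mulr_ge0 ?powR_ge0 ?(ltW s0) //.
have sq : \sum_(j < N) md (g (x j)) ^+ 2 <= 2 * C ^+ 2 -> \sum_j t j ^+ 2 <= 1.
  move=> h; under eq_bigr do rewrite /t expr_div_n.
  rewrite -mulr_suml ler_pdivrMr ?exprn_gt0 // mul1r; apply: le_trans h _.
  by rewrite /D; nra.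
apply: block_weak_sum_le => // [j|].
  rewrite t0 /= ler_pdivrMr // mul1r.
  apply: le_trans (gC _) _; apply: (@le_trans _ _ (C * 1)).
    by rewrite ler_wpM2l.
  by rewrite /D; lra.
case: hb => [->|[-> p2 /sq h]|[-> /sq h]]; first by constructor 1.
  by constructor 2.
by constructor 3.
Qed.

End WeakSummability.

Unset Implicit Arguments.

(* Banach spaces are nonzero: if some X i is zero, then A = 0 is the only
   n-linear form, and it is dominated. *)
Theorem proposition3p2 (R : realType) (k : scalar_kind) (n : nat)
    (X : 'I_n -> completeNormedModType (scalar_field R k)) (p : 'I_n -> R)
    (hn : (3 <= n)%N)
    (hX0 : forall i, exists x : X i, x != 0)
    (hXinf : exists S : {set 'I_n},
       (3 <= #|S|)%N /\ forall i, i \in S -> infinite_dimensional (X i))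
    (hp : forall i, 1 <= p i) :
  exists A : (forall i, X i) -> (scalar_field R k)^o,
    continuous_multilinear A /\ ~ dominated p A.
Proof.
have [S [/card_gt2P[a [b [c [[aS bS cS] [ab bc ca]]]]] Sinf]] := hXinf.
have p0 i : 0 < p i by apply: lt_le_trans (hp i).
set q := (\sum_i (p i)^-1)^-1.
have q0 : 0 < q.
  rewrite invr_gt0 (bigD1 a) //= ltr_pwDl ?invr_gt0 //.
  by apply: sumr_ge0 => i _; rewrite invr_ge0 ltW.
(* For [2 <= p a] weak 2-summability already implies weak [p a]-summability.
   For [p a < 2] the scaling by [N `^ (- 2^-1)] makes weakly 2-summable vectors
   weakly 1-summable. *)
pose sigma := if 2 <= p a then 0 else 2^-1 : R.
pose beta i := if i == a then sigma else (p i)^-1.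
pose delta := (p a)^-1 - sigma.
have delta0 : 0 < delta.
  rewrite /delta /sigma; have [p2|p2] := leP 2 (p a).
    by rewrite subr0 invr_gt0.
  by rewrite subr_gt0 ltf_pV2 ?posrE ?p0.
have sum_beta : \sum_i beta i = q^-1 - delta.
  rewrite /q invrK (bigD1 a) //= [in RHS](bigD1 a) //= /beta eqxx /delta.
  rewrite (eq_bigr (fun i => (p i)^-1)); first by ring.
  by move=> i /negbTE->.
pose s l : R := 2^-1 ^+ l.
have s0 l : 0 < s l by rewrite exprn_gt0 // invr_gt0.
pose cst l := s l * (s l `^ q^-1 * 4^-1 ^+ n).
have cst0 l : 0 < cst l by rewrite !mulr_gt0 ?powR_gt0 ?exprn_gt0 // invr_gt0.
have /choice[N hN] : forall l : nat, exists N, (0 < N)%N /\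
    l%:R <= N%:R * (cst l * N%:R `^ (- (q^-1 - delta))) `^ q.
  by move=> l; exact: exists_block_size.
have fam l i : exists fx : (nat -> X i -> scalar_field R k) * (nat -> X i),
    block_family (N l) (i \in [:: b; c]) (i == a) fx.1 fx.2.
  have [|||f [x h]] := @exists_block_family R k (X i) (N l)
    (i \in [:: b; c]) (i == a); last by exists (f, x).
  - exact: hX0.
  - by rewrite !inE -orbA => /or3P[] /eqP ->; exact: Sinf.
  - apply/negP; rewrite !inE => /andP[/orP[] /eqP -> /eqP E].
      by rewrite E eqxx in ab.
    by rewrite E eqxx in ca.
pose f l i := (projT1 (cid (fam l i))).1.
pose x0 l i := (projT1 (cid (fam l i))).2.
have hfam l i : block_family (N l) (i \in [:: b; c]) (i == a) (f l i) (x0 l i).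
  exact: projT2 (cid (fam l i)).
pose lam l i := s l `^ (p i)^-1 * (N l)%:R `^ (- beta i).
pose x l i j := emb k (lam l i) *: x0 l i j.
have lf l i j : lform (f l i j) by have [+ _ _ _ _] := hfam l i.
have f_le l i j y : modulus (f l i j y) <= 2 * nrm y.
  by have [_ + _ _ _] := hfam l i.
have f_weak2 l i (y : X i) : i \in [:: b; c] ->
    \sum_(j < N l) modulus (f l i j y) ^+ 2 <= 2 * nrm y ^+ 2.
  by move=> ibc; have [_ _ _ _ [+ _]] := hfam l i; exact.
have lam_prod l : \prod_i lam l i =
    s l `^ q^-1 * (N l)%:R `^ (- (q^-1 - delta)).
  have Nl0 : 0 < (N l)%:R :> R by rewrite ltr0n; have [] := hN l.
  by rewrite big_split /= !prod_powR // sumrN sum_beta /q invrK.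
have big l : l%:R <= \sum_(j < N l)
    (2^-1 ^+ l * modulus (form_term f l j (fun i => x l i j))) `^ q.
  have [Nl0 h] := hN l; apply: le_trans h _.
  rewrite mulr_natl -[X in _ *+ X]card_ord -sumr_const; apply: ler_sum => j _.
  have P0 : 0 <= (N l)%:R `^ (- (q^-1 - delta)) :> R by exact: powR_ge0.
  apply: ge0_ler_powR; first exact: ltW.
  - by rewrite nnegrE mulr_ge0 // ltW.
  - by rewrite nnegrE mulr_ge0 ?modulus_ge0 // ltW // s0.
  rewrite /cst -mulrA ler_wpM2l //; first exact: ltW (s0 l).
  rewrite mulrAC -lam_prod /form_term modulus_prod.
  rewrite -[n in _ ^+ n]card_ord -prodr_const -big_split /=.
  have lam0 i : 0 <= lam l i by rewrite mulr_ge0 ?powR_ge0.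
  apply: ler_prod => i _; apply/andP; split; first by rewrite mulr_ge0 // invr_ge0.
  rewrite lformZ // modulusM modulus_emb ger0_norm // ler_wpM2l //.
  by have [_ _ _ + _] := hfam l i; apply.
have [th hth] := exists_unbounded_form bc f_le f_weak2 q0 big.
exists (block_form bc f_le f_weak2 th); split.
  split; first exact: block_form_multilinear.
  exact: block_form_continuous.
(* The blocks of test points are arranged in one sequence, with zeros at the
   pairs [(l, j)] such that [N l <= j]. *)
have /card_set_bijP[e be] : ([set: nat] #= [set: nat * nat])%card.
  by rewrite card_eq_sym card_nat2.
pose xs i m := if ((e m).2 < N (e m).1)%N then x (e m).1 i (e m).2 else 0.
move=> dom.
have weak i : weak_ell (p i) (xs i).
  move=> phi /linear_continuous_bound[C C0 phiC].
  have lphi : lform phi by move=> u y z; rewrite linearP.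
  pose G l j := modulus (phi (if (j < N l)%N then x l i j else 0)) `^ p i.
  apply: (@block_sums_lty R e N G (2 * (2 * C + 1) `^ p i) be).
  - by move=> l j; exact: powR_ge0.
  - by move=> l j Nj; rewrite /G ltnNge Nj /= linear0 modulus0 powR0 // gt_eqF.
  - move=> l; rewrite (eq_bigr (fun j : 'I_(N l) => modulus (phi (x l i j)) `^ p i)).
      have [_ _ x1 _ [_ hx]] := hfam l i.
      apply: (weak_block_le (b := beta i)) => //; first by have [] := hN l.
      rewrite /beta; case: eqP hx => [ia|_ _]; last by constructor 1.
      move=> /(_ isT phi C lphi C0 phiC) hx; rewrite /sigma -ia.
      by have [p2|_] := leP 2 (p i); [constructor 2|constructor 3].
    by move=> j _; rewrite /G ltn_ord.
have [C hC] := block_sums_bounded N (G := fun l j =>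
  modulus (block_form bc f_le f_weak2 th
    (fun i => if (j < N l)%N then x l i j else 0)) `^ q)
  be (fun _ _ => powR_ge0 _ _) (dom xs weak).
have [l] := hth (C + 1); have := hC l.
under eq_bigr do rewrite ltn_ord.
lra.
Qed.
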